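(* For each prime $\ell\ge 3$ let $\mathcal{K}_\ell$ denote the set of positive integers $k\le \ell-2$ for which the Demjanenko matrix $D_{k,\ell}$ is singular. For integers $\beta\ge 0$ and $m\ge 1$ with $\gcd(m,6)=1$, let $\mathcal{L}_{\beta,m}$ be the set of primes $\ell$ of the form $\ell=2^{\alpha}3^{\beta}m+1$, for some integer $\alpha>0$, such that $\#\mathcal{K}_\ell>0$. Then for any fixed $\beta\ge 0$ and $m\ge 1$ with $\gcd(m,6)=1$, the set $\mathcal{L}_{\beta,m}$ is finite. More precisely, if $\beta=0$ then $\#\mathcal{L}_{\beta,m}=0$, and for $\beta\ge 1$ we have $$\#\mathcal{L}_{\beta,m}=O\left(3^{2\beta}m^2/\beta\right),$$ where the implied constant is absolute (independent of $\beta$ and $m$).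
   Context: For a prime $\ell\ge 3$ and $j\in(\mathbb{Z}/\ell\mathbb{Z})^*$, let $\langle j\rangle_\ell$ be the unique integer representative of $j$ modulo $\ell$ in $\{1,\dots,\ell-1\}$. For a positive integer $k\le \ell-2$ define $$M_{k,\ell}:=\{j\in(\mathbb{Z}/\ell\mathbb{Z})^* : \langle kj\rangle_\ell+\langle j\rangle_\ell<\ell\},$$ a set of cardinality $(\ell-1)/2$, and its stabilizer, the subgroup $$W_{k,\ell}:=\{w\in(\mathbb{Z}/\ell\mathbb{Z})^* : wM_{k,\ell}=M_{k,\ell}\}.$$ For $a\in(\mathbb{Z}/\ell\mathbb{Z})^*$ put $E_{k,\ell}(a):=0$ if $a\in M_{k,\ell}$ and $E_{k,\ell}(a):=1$ if $a\notin M_{k,\ell}$. The Demjanenko matrix is the square rational matrix $$D_{k,\ell}:=\left(E_{k,\ell}(-c^{-1}a)-\tfrac12\right)_{c,a\in M_{k,\ell}/W_{k,\ell}},$$ whose rows and columns are indexed by the $W_{k,\ell}$-orbits in $M_{k,\ell}$ (the entry does not depend on the chosen representatives $c,a$). *)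

(* Defs.v *)
From HB Require Import structures.
From mathcomp Require Import all_boot all_order all_algebra all_fingroup.
From mathcomp Require Import finmap classical_sets cardinality.

Set Implicit Arguments.
Unset Strict Implicit.
Unset Printing Implicit Defensive.

Import GRing.Theory Num.Theory.

(* The definitions below depend on arbitrary naturals k and l; they carry
   their meaning for l an odd prime, in which case 'F_l is the field Z/lZ and
   {unit 'F_l} its multiplicative group, and 1 <= k <= l - 2. *)

Definition least_residue (l : nat) (x : 'F_l) : nat := val x.

Definition unit_opp (l : nat) (u : {unit 'F_l}) : {unit 'F_l} :=
  FinRing.unit 'F_l (etrans (unitrN (FinRing.uval u)) (valP u)).

Definition demj_set (k l : nat) : {set {unit 'F_l}} :=
  [set j : {unit 'F_l} |
     least_residue (k%:R * FinRing.uval j)%R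
       + least_residue (FinRing.uval j) < l].

Definition demj_stab (k l : nat) : {set {unit 'F_l}} :=
  [set w : {unit 'F_l} | (w *: demj_set k l)%g == demj_set k l].

Definition demj_E (k l : nat) (a : {unit 'F_l}) : nat :=
  if a \in demj_set k l then 0 else 1.

(* The orbit of a under multiplication by W is the coset W :* a. *)
Definition demj_orbits (k l : nat) : {set {set {unit 'F_l}}} :=
  rcosets (demj_stab k l) (demj_set k l).

Definition demj_entry (k l : nat) (c a : {unit 'F_l}) : rat :=
  ((demj_E k (unit_opp (c^-1 * a)%g))%:R - 1 / 2%:R)%R.

Lemma demj_stabM (k l : nat) (w x : {unit 'F_l}) :
  w \in demj_stab k l -> ((w * x)%g \in demj_set k l) = (x \in demj_set k l).
Proof.
by rewrite inE => /eqP defM; rewrite -{1}defM mem_lcoset mulKg.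
Qed.

Lemma demj_entry_indep (k l : nat) (c c' a a' : {unit 'F_l}) :
  c' \in (demj_stab k l :* c)%g -> a' \in (demj_stab k l :* a)%g ->
  demj_entry k c' a' = demj_entry k c a.
Proof.
have commU (u v : {unit 'F_l}) : (u * v = v * u)%g.
  by apply: val_inj; exact: mulrC.
have oppM (u v : {unit 'F_l}) : (u * unit_opp v = unit_opp (u * v))%g.
  by apply: val_inj; exact: mulrN.
move=> /rcosetP[v Wv ->] /rcosetP[w Ww ->]; congr ((_)%:R - _)%R.
rewrite /demj_E -(demj_stabM _ Wv) oppM.
have -> : (v * ((v * c)^-1 * (w * a)) = w * (c^-1 * a))%g.
  rewrite invMg (commU (c^-1)%g v^-1%g) -mulgA mulKVg.
  by rewrite mulgA (commU (c^-1)%g w) -mulgA.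
by rewrite -oppM demj_stabM.
Qed.

(* Rows and columns are indexed by the same enumeration of the orbits; each
   orbit is represented by repr, and by demj_entry_indep any other choice of
   representatives gives the same matrix. *)
Definition demj_matrix (k l : nat) : 'M[rat]_(#|demj_orbits k l|) :=
  (\matrix_(i, j) demj_entry k (repr (enum_val i)) (repr (enum_val j)))%R.

Definition singular_ks (l : nat) : {set 'I_l} :=
  [set k : 'I_l | (0 < k <= l - 2) && (\det (demj_matrix k l) == 0)%R].

Definition singular_primes (beta m : nat) : set nat :=
  [set l : nat | [/\ prime l,
     exists2 alpha : nat, 0 < alpha & l = 2 ^ alpha * 3 ^ beta * m + 1
     & 0 < #|singular_ks l| ]]%classic.

(* Main.v *)
(* The matrix is, up to the choice of representatives, the matrix of convolution
   by the odd function E - 1/2 on odd functions on G / W, G = (Z/lZ)^*.  So if it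
   is singular, the sum of chi(a) E(a) vanishes for some odd character chi of G
   that is trivial on W.  From l E(a) = <ka> + <a> - <(k+1)a> this sum is
   (psi(k) + 1 - psi(k+1)) B / l, where psi = 1/chi and B is the sum of
   chi(a) <a>.

   B is nonzero (in classical terms, L(1, psi) is nonzero).  If chi is real, then
   l = 3 mod 4 and B is an odd integer.  Otherwise B = 0 would give, through
   Gauss sums and the Fourier series of the sawtooth, L(1, psi) = 0 with partial
   sums O(1/N), against the 3-4-1 inequality near s = 1.

   So psi(k) + 1 = psi(k+1) is a relation between roots of unity, and
   mu = psi(k) satisfies mu^2 + mu + 1 = 0.  Put n = 3^beta m, so that
   l - 1 = 2^alpha n with n odd.  Then 3 divides n, which excludes beta = 0, and
   since psi(-1) = -1 the 2-parts of k and of -(k+1) are trivial: k^n = 1 and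
   (k+1)^n = -1 in F_l.  Moreover k^2 + k + 1 is nonzero in F_l, as otherwise k
   would lie in W and psi(k) = 1.  Hence l divides the resultant of
   (X^n - 1)/(X^2 + X + 1) and (X + 1)^n + 1, which is a nonzero integer below
   2^(2 n^2).  All these primes l exceed 2^beta, so there are at most
   2 n^2 / beta of them. *)

Require Import Defs.
From mathcomp Require Import all_boot all_order all_algebra all_fingroup.
From mathcomp Require Import cyclic separable algC cyclotomic.
From mathcomp Require Import finmap classical_sets cardinality.
From mathcomp Require Import Rstruct complex boolp functions set_interval reals.
From mathcomp Require Import topology normedtype sequences derive realfun exp.
From mathcomp Require Import trigo.
From mathcomp Require Import ring lra zify.

Set Implicit Arguments.
Unset Strict Implicit.
Unset Printing Implicit Defensive.

(** * Resultants *)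

Section Resultant.
Import Order.TTheory GRing.Theory Num.Theory.
Local Open Scope ring_scope.

(** Expanding the product of the row sums gives one nonnegative term for each map from rows to
    columns; the injective maps already give all the terms of the Leibniz formula. *)
Lemma ler_norm_det (R : numDomainType) n (M : 'M[R]_n) :
  `|\det M| <= \prod_i \sum_j `|M i j|.
Proof.
rewrite bigA_distr_bigA /= (bigID (fun f : {ffun 'I_n -> 'I_n} => injectiveb f)) /=.
rewrite (le_trans (ler_norm_sum _ _ _))// ler_wpDr ?sumr_ge0// => [f _|].
  by rewrite prodr_ge0.
rewrite [leRHS](reindex_onto (fun s : 'S_n => val s) (insubd (1%g : 'S_n))) /=.
  rewrite [leRHS](eq_bigl xpredT) => [|s]; last first.
    by rewrite valKd eqxx andbT; exact: (valP s).
  apply: ler_sum => s _; rewrite normrM normrX normrN1 expr1n mul1r normr_prod.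
  by apply: ler_prod => i _; rewrite normr_ge0 /= -pvalE.
by move=> f injf; rewrite val_insubd injf.
Qed.

(** * The l1 norm of coefficients and the size of resultants *)

Section L1.
Variable R : numDomainType.
Implicit Types p q : {poly R}.

Definition l1norm (p : {poly R}) := \sum_(i < size p) `|p`_i|.

Lemma l1norm_widen p n : (size p <= n)%N -> l1norm p = \sum_(i < n) `|p`_i|.
Proof.
move=> len; rewrite /l1norm (big_ord_widen n (fun i => `|p`_i|) len) big_mkcond.
by apply: eq_bigr => i _; case: ltnP => // /(nth_default 0) ->; rewrite normr0.
Qed.

Lemma l1norm_ge0 p : 0 <= l1norm p. Proof. exact: sumr_ge0. Qed.

Lemma l1normD p q : l1norm (p + q) <= l1norm p + l1norm q.
Proof.
rewrite (@l1norm_widen (p + q) (maxn (size p) (size q))) ?size_polyD//.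
rewrite (@l1norm_widen p (maxn (size p) (size q))) ?leq_maxl//.
rewrite (@l1norm_widen q (maxn (size p) (size q))) ?leq_maxr//.
by rewrite -big_split; apply: ler_sum => i _; rewrite coefD ler_normD.
Qed.

Lemma l1normN p : l1norm (- p) = l1norm p.
Proof. by rewrite /l1norm size_polyN; apply: eq_bigr => i _; rewrite coefN normrN. Qed.

Lemma l1norm_1 : l1norm 1 = 1.
Proof. by rewrite /l1norm size_poly1 big_ord1 coef1 normr1. Qed.

Lemma l1norm_mulX p : l1norm (p * 'X) = l1norm p.
Proof.
rewrite (@l1norm_widen _ (size p).+1) ?(leq_trans (size_polyMleq _ _)) ?size_polyX ?addn2//.
rewrite big_ord_recl coefMX eqxx normr0 add0r.
by apply: eq_bigr => i _; rewrite coefMX.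
Qed.

Lemma l1normXn n : l1norm 'X^n = 1.
Proof. by elim: n => [|n IHn]; rewrite ?expr0 ?l1norm_1 // exprSr l1norm_mulX. Qed.

Lemma l1norm_sum n (F : nat -> {poly R}) :
  l1norm (\sum_(i < n) F i) <= \sum_(i < n) l1norm (F i).
Proof.
elim: n => [|n IHn]; first by rewrite !big_ord0 /l1norm size_poly0 big_ord0.
by rewrite !big_ord_recr/= (le_trans (l1normD _ _))// lerD2r.
Qed.

(** The summands are the entries of a row of a Sylvester matrix: the coefficients of [p] shifted by
    [k] and cut at [m] columns. *)
Lemma sum_band_le p k m :
  \sum_(j < m) `|p`_(j - k) *+ (k <= j)| <= l1norm p.
Proof.
rewrite -(big_mkord xpredT (fun j => `|p`_(j - k) *+ (k <= j)%N|)).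
have [lemk|ltkm] := leqP m k.
  rewrite big_nat big1 ?l1norm_ge0// => j /andP[_ ltjm].
  by rewrite leqNgt (leq_trans ltjm lemk) normr0.
rewrite (@big_cat_nat _ _ _ k)//= ?(ltnW ltkm)// big_nat big1 ?add0r; last first.
  by move=> j /andP[_ ltjk]; rewrite leqNgt ltjk normr0.
rewrite -{1}[k]add0n big_addn big_mkord.
rewrite (@l1norm_widen p (maxn (m - k) (size p))) ?leq_maxr//.
rewrite (big_ord_widen (maxn (m - k) (size p)) (fun i =>
  `|p`_(i + k - k) *+ (k <= i + k)%N|)) ?leq_maxl//.
rewrite big_mkcond; apply: ler_sum => i _; rewrite addnK leq_addl.
by case: ifP.
Qed.

(** The Sylvester matrix has [(size q).-1] rows of shifts of [p] and [(size p).-1] rows of shifts of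
    [q]; the determinant is bounded by the product of the row sums. *)
Lemma norm_resultant_le (p q : {poly R}) :
  `|resultant p q| <= l1norm p ^+ (size q).-1 * l1norm q ^+ (size p).-1.
Proof.
rewrite (le_trans (ler_norm_det _))// big_split_ord /=.
rewrite ler_pM ?prodr_ge0 //.
- by move=> i _; rewrite sumr_ge0.
- by move=> i _; rewrite sumr_ge0.
- rewrite -[X in _ ^+ X]card_ord -prodr_const; apply: ler_prod => i _.
  rewrite sumr_ge0//= (le_trans _ (sum_band_le p i ((size q).-1 + (size p).-1)))//.
  apply: ler_sum => j _.
  by rewrite Sylvester_mxE (unsplitK (inl i : _ + 'I_(size p).-1)).
- rewrite -[X in _ ^+ X]card_ord -prodr_const; apply: ler_prod => i _.
  rewrite sumr_ge0//= (le_trans _ (sum_band_le q i ((size q).-1 + (size p).-1)))//.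
  apply: ler_sum => j _.
  by rewrite Sylvester_mxE (unsplitK (inr i : 'I_(size q).-1 + _)).
Qed.

End L1.

(** On the unit circle the conjugate of z is 1/z, so |z + 1| = 1 reads z + 1/z + 1 = 0. *)
Lemma norm1_add1 (C : numClosedFieldType) (z : C) :
  `|z| = 1 -> `|z + 1| = 1 -> z ^+ 2 + z + 1 = 0.
Proof.
move=> z1 z2; have zz : z * z^* = 1 by rewrite -normCK z1 expr1n.
have : (z + 1) * (z + 1)^* = 1 by rewrite -normCK z2 expr1n.
rewrite rmorphD rmorph1 mulrDr mulrDl zz mul1r => h.
have h' : z + z^* + 1 = 0 by apply: (addIr 1); rewrite add0r -[RHS]h; ring.
by rewrite -(mulr0 z) -h' !mulrDr zz mulr1; ring.
Qed.

(** * The two polynomials whose resultant the primes must divide *)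

Section RingPolys.
Variable R : comNzRingType.

(* [(X ^ (3 q) - 1) / (X ^ 2 + X + 1)] *)
Definition unity_quotient q : {poly R} :=
  \sum_(i < q) ('X^((3 * i).+1) - 'X^(3 * i)).

Definition shifted_unity n : {poly R} := ('X + 1) ^+ n + 1.

Lemma unity_quotientM q :
  unity_quotient q * ('X^2 + 'X + 1) = 'X^(3 * q) - 1.
Proof.
elim: q => [|q IHq]; first by rewrite /unity_quotient big_ord0 mul0r muln0 expr0 subrr.
rewrite /unity_quotient big_ord_recr/= mulrDl IHq mulnS exprSr exprD; ring.
Qed.

(** At a cube root of unity x the value is q (x - 1), which in characteristic 0 vanishes only for x
    = 1. *)
Lemma horner_unity_quotient q (x : R) :
  (unity_quotient q).[x] = (x - 1) * \sum_(i < q) (x ^+ 3) ^+ i.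
Proof.
rewrite /unity_quotient horner_sum mulr_sumr; apply: eq_bigr => i _.
by rewrite !hornerE -exprM exprS; ring.
Qed.

Lemma size_unity_quotient q : (0 < q)%N -> size (unity_quotient q) = (3 * q).-1.
Proof.
move=> q_gt0; have := congr1 (fun p => size (polyseq p)) (unity_quotientM q).
have szn : size ('X^(3 * q) - 1 : {poly R}) = (3 * q).+1.
  by rewrite size_XnsubC// muln_gt0.
have m3 : ('X^2 + 'X + 1 : {poly R}) \is monic.
  by rewrite monicE -addrA lead_coefDl ?lead_coefXn// size_polyXn size_XaddC.
have s3 : size ('X^2 + 'X + 1 : {poly R}) = 3.
  by rewrite -addrA size_polyDl size_polyXn// size_XaddC.
have nz : unity_quotient q != 0.
  apply/eqP => h; have := unity_quotientM q; rewrite h mul0r => /esym h'.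
  by move: szn; rewrite h' size_poly0.
rewrite szn size_Mmonic// s3 addnC /= => [[h]]; lia.
Qed.

Lemma size_shifted_unity n : (0 < n)%N -> size (shifted_unity n) = n.+1.
Proof.
move=> n_gt0; have h : size (('X + 1 : {poly R}) ^+ n) = n.+1.
  have -> : 'X + 1 = 'X - (-1)%:P :> {poly R} by rewrite rmorphN opprK.
  exact: size_exp_XsubC.
by rewrite /shifted_unity size_polyDl h// size_poly1.
Qed.

End RingPolys.

Lemma map_unity_quotient (R S : comNzRingType) (f : {rmorphism R -> S}) q :
  map_poly f (unity_quotient R q) = unity_quotient S q.
Proof.
rewrite /unity_quotient rmorph_sum; apply: eq_bigr => i _.
by rewrite rmorphB/= !map_polyXn.
Qed.

Lemma map_shifted_unity (R S : comNzRingType) (f : {rmorphism R -> S}) n :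
  map_poly f (shifted_unity R n) = shifted_unity S n.
Proof. by rewrite /shifted_unity rmorphD rmorphXn rmorphD/= map_polyX !rmorph1. Qed.

Definition unity_resultant q : int :=
  resultant (unity_quotient int q) (shifted_unity int (3 * q)).

(** A common complex root z satisfies z^(3q) = 1 and (z + 1)^(3q) = -1, so z and z + 1 lie on the
    unit circle and z is a primitive cube root of unity. There the first polynomial has the nonzero
    value q (z - 1). *)
Lemma unity_resultant_neq0 q : (0 < q)%N -> unity_resultant q != 0.
Proof.
move=> q_gt0; apply/negP => /eqP res0.
move/eqP: res0; rewrite resultant_eq0 => gt1.
pose f : {rmorphism int -> algC} := intr.
(* Divisibility over [int] is pseudo-divisibility: only a nonzero multiple [c] of [p] factors
   through [g]. *)
have root_dvd (p g : {poly int}) z : g %| p -> root (map_poly f g) z -> (map_poly f p).[z] = 0.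
  move=> /Pdiv.Idomain.dvdpP[[c u]/= c0 /(congr1 (map_poly f)) e] /rootP gz.
  move: e => /(congr1 (horner^~ z)); rewrite map_polyZ rmorphM/= hornerZ hornerM gz mulr0.
  by move/eqP; rewrite mulf_eq0 intr_eq0 (negPf c0) => /eqP.
have : size (map_poly f (gcdp (unity_quotient int q) (shifted_unity int (3 * q)))) != 1%N.
  by rewrite size_map_inj_poly ?gtn_eqF//; exact: intr_inj.
move=> /closed_rootP [z gz].
have := root_dvd _ _ z (dvdp_gcdl _ _) gz; rewrite map_unity_quotient => Az.
have := root_dvd _ _ z (dvdp_gcdr _ _) gz; rewrite map_shifted_unity.
rewrite /shifted_unity !hornerE => /eqP; rewrite addr_eq0 => /eqP Pz.
have n_gt0 : (0 < 3 * q)%N by lia.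
have zn : z ^+ (3 * q) = 1.
  apply/eqP; rewrite -subr_eq0; have := congr1 (horner^~ z) (unity_quotientM algC q).
  by rewrite hornerM Az mul0r !hornerE => <-.
have z1 : `|z| = 1 by apply/eqP; rewrite -(pexpr_eq1 n_gt0)// -normrX zn normr1.
have z2 : `|z + 1| = 1.
  by apply/eqP; rewrite -(pexpr_eq1 n_gt0)// -normrX Pz normrN1.
have h := norm1_add1 z1 z2.
have z3 : z ^+ 3 = 1.
  by apply/eqP; rewrite -subr_eq0 -(mulr0 (z - 1)) -h; apply/eqP; ring.
move: Az; rewrite horner_unity_quotient z3.
rewrite (eq_bigr (fun=> 1)) => [|i _]; last by rewrite expr1n.
rewrite sumr_const card_ord => /eqP; rewrite mulf_eq0 pnatr_eq0 gtn_eqF// orbF.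
rewrite subr_eq0 => /eqP z_1; move: h; rewrite z_1 expr1n => h.
have /eqP : (3%:R : algC) = 0 by rewrite -h; ring.
by rewrite pnatr_eq0.
Qed.

(** With n = 3q the l1 norms are at most 2^n and 2^(n+1) and the degrees are n - 2 and n, so the
    exponent of 2 is at most n^2 + (n + 1)(n - 2), which is below 2 n^2. *)
Lemma unity_resultant_le q :
  (0 < q)%N -> (absz (unity_resultant q) <= 2 ^ (2 * (3 * q) ^ 2))%N.
Proof.
move=> q_gt0.
have := @norm_resultant_le int (unity_quotient int q) (shifted_unity int (3 * q)).
rewrite size_unity_quotient// size_shifted_unity; last by lia.
move=> /le_trans h.
suff : `|unity_resultant q| <= ((2 ^ (2 * (3 * q) ^ 2))%N)%:R :> int by lia.
apply: h => /=.
have lA : l1norm (unity_quotient int q) <= 2 ^+ (3 * q).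
  apply: (@le_trans _ _ (\sum_(i < q) 2)); last first.
    have : (2 * q <= 2 ^ (3 * q))%N.
      by rewrite (leq_trans (ltnW (ltn_expl _ (isT : 1 < 2)%N)))// leq_exp2l//; lia.
    by rewrite -(ler_nat int) natrM natrX sumr_const card_ord mulr_natr.
  rewrite (le_trans (l1norm_sum _ (fun i => 'X^((3 * i).+1) - 'X^(3 * i))))//.
  by apply: ler_sum => i _; rewrite (le_trans (l1normD _ _))// l1normN !l1normXn.
have lX : l1norm (('X + 1 : {poly int}) ^+ (3 * q)) <= 2 ^+ (3 * q).
  elim: (3 * q)%N => [|n IHn]; first by rewrite !expr0 l1norm_1.
  by rewrite exprSr mulrDr mulr1 (le_trans (l1normD _ _))// l1norm_mulX exprSr mulr_natr
    mulr2n lerD//.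
have lP : l1norm (shifted_unity int (3 * q)) <= 2 ^+ (3 * q).+1.
  rewrite (le_trans (l1normD _ _))// l1norm_1 exprS.
  rewrite mulr_natl mulr2n; apply: lerD => //.
  by apply: exprn_ege1.
rewrite (@le_trans _ _ ((2 ^+ (3 * q)) ^+ (3 * q) * (2 ^+ (3 * q).+1) ^+ (3 * q).-1.-1))//.
  by rewrite ler_pM ?exprn_ge0 ?l1norm_ge0// lerXn2r// nnegrE ?l1norm_ge0 ?exprn_ge0.
rewrite -!exprM -exprD natrX ler_eXn2l//; nia.
Qed.

(** The resultant is an integral combination of the two polynomials. Modulo [l] both vanish at [x],
    the first because [x] is a root of X^(3q) - 1 but not of X^2 + X + 1. *)
Lemma dvdn_unity_resultant (l q : nat) (x : 'F_l) : prime l -> (0 < q)%N ->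
  x ^+ (3 * q) = 1 -> (x + 1) ^+ (3 * q) = -1 -> x ^+ 2 + x + 1 != 0 ->
  (l %| absz (unity_resultant q))%N.
Proof.
move=> l_pr q_gt0 xn x1n x3.
have [] := @resultant_in_ideal int (unity_quotient int q) (shifted_unity int (3 * q)).
- by rewrite size_unity_quotient//; lia.
- by rewrite size_shifted_unity; lia.
move=> [u v] /= _ /(congr1 (map_poly (intr : int -> 'F_l))).
rewrite rmorphD !rmorphM/= map_unity_quotient map_shifted_unity map_polyC/=.
move=> /(congr1 (horner^~ x)).
have -> : (horner^~ x) (map_poly intr u * unity_quotient 'F_l q
    + map_poly intr v * shifted_unity 'F_l (3 * q)) = 0.
  have Ax : (unity_quotient 'F_l q).[x] = 0.
    have := congr1 (horner^~ x) (unity_quotientM 'F_l q).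
    rewrite hornerM !hornerE xn subrr => /eqP.
    by rewrite mulf_eq0 (negPf x3) orbF => /eqP.
  by rewrite hornerD !hornerM Ax mulr0 add0r /shifted_unity !hornerE x1n addNr mulr0.
rewrite hornerC -/(unity_resultant q) => /eqP.
case: (unity_resultant q) => [n|n] /=.
  by rewrite -pmulrn -(dvdn_pcharf (pchar_Fp l_pr)).
by rewrite NegzE mulrNz oppr_eq0 -pmulrn -(dvdn_pcharf (pchar_Fp l_pr)).
Qed.

End Resultant.

(** * Truncated Euler products *)

Section EulerProduct.
Import Order.TTheory GRing.Theory Num.Theory.
Local Open Scope ring_scope.
Local Open Scope complex_scope.

Variable R : realType.
Implicit Types (e : R) (n : nat) (z : R[i]).
Local Notation normc := (@Normc.normc R).

Lemma normc_ge0 z : 0 <= normc z.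
Proof. by case: z => a b; rewrite sqrtr_ge0. Qed.

Lemma normcD z1 z2 : normc (z1 + z2) <= normc z1 + normc z2.
Proof. exact: le_normcD. Qed.

Lemma normc_opp z : normc (- z) = normc z.
Proof. exact: normcN. Qed.

Lemma normc_real (x : R) : normc x%:C = `|x|.
Proof. by rewrite /= expr0n /= addr0 sqrtr_sqr. Qed.

Lemma le_normc_sum (I : Type) (s : seq I) (P : pred I) (F : I -> R[i]) :
  normc (\sum_(i <- s | P i) F i) <= \sum_(i <- s | P i) normc (F i).
Proof.
elim/big_rec2: _ => [|i x y _ le_xy]; first by rewrite Normc.normc0.
by rewrite (le_trans (normcD _ _))// lerD2l.
Qed.

Lemma normc_prod (I : Type) (s : seq I) (F : I -> R[i]) :
  normc (\prod_(i <- s) F i) = \prod_(i <- s) normc (F i).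
Proof. by apply: (big_morph _ (@Normc.normcM R)); exact: Normc.normc1. Qed.

Lemma normcX z n : normc (z ^+ n) = normc z ^+ n.
Proof. by elim: n => [|n IHn]; rewrite ?expr0 ?Normc.normc1// !exprS Normc.normcM IHn. Qed.

Lemma normcB z1 z2 : normc (z1 - z2) = normc (z2 - z1).
Proof. by rewrite -opprB normc_opp. Qed.

(** This is n^(-e); Dirichlet series at s = 1 + e are written with the weights [npow e n / n%:R]. *)
Definition npow e n : R := expR (- (e * ln n%:R)).

Lemma npow_gt0 e n : 0 < npow e n. Proof. exact: expR_gt0. Qed.

Lemma npow1 e : npow e 1 = 1.
Proof. by rewrite /npow ln1 mulr0 oppr0 expR0. Qed.

Lemma npowM e m n : (0 < m)%N -> (0 < n)%N -> npow e (m * n) = npow e m * npow e n.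
Proof.
move=> m_gt0 n_gt0; rewrite /npow natrM lnM ?posrE ?ltr0n//.
by rewrite mulrDr opprD expRD.
Qed.

(** From (1 + 1/n)^(-e) >= 1 - e ln(1 + 1/n) >= 1 - e/n. *)
Lemma npow_step_le e n : 0 < e -> (0 < n)%N ->
  npow e n - npow e n.+1 <= e * (npow e n / n%:R).
Proof.
move=> e_gt0 n_gt0; have n0 : 0 < n%:R :> R by rewrite ltr0n.
have n1E : n.+1%:R = n%:R * (1 + n%:R^-1) :> R.
  by rewrite mulrDr mulfV ?gt_eqF// mulr1 -natr1.
rewrite {2}/npow n1E lnM ?posrE//; last by rewrite ltr_wpDr ?invr_ge0 ?ltr0n ?ler0n.
rewrite mulrDr opprD expRD -/(npow e n).
have h1 := expR_ge1Dx (- (e * ln (1 + n%:R^-1))).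
have h2 : e * ln (1 + n%:R^-1) <= e * n%:R^-1.
  by rewrite ler_pM2l// le_ln1Dx// (lt_le_trans (_ : -1 < 0))// ?invr_ge0 ?ler0n// ltrN10.
have := npow_gt0 e n; set a := npow e n; set b := expR _ in h1 *.
move: h1 h2; set c := e * ln _; set d := n%:R^-1 => h1 h2 a0; nra.
Qed.

(** The companion bound, from n = (n + 1)(1 - 1/(n + 1)); it makes the tail of the series for zeta(1
    + e) telescope. *)
Lemma npow_step_ge e n : 0 < e -> (0 < n)%N ->
  e * (npow e n.+1 / n.+1%:R) <= npow e n - npow e n.+1.
Proof.
move=> e_gt0 n_gt0; have n0 : 0 < n%:R :> R by rewrite ltr0n.
have n1 : 0 < n.+1%:R :> R by rewrite ltr0n.
have nE : n%:R = n.+1%:R * (1 - n.+1%:R^-1) :> R.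
  by rewrite mulrBr mulfV ?gt_eqF// mulr1 -natr1 addrK.
have lt1 : n.+1%:R^-1 < 1 :> R by rewrite invf_lt1// ltr1n ltnS.
rewrite [X in _ <= X - _]/npow nE lnM ?posrE ?subr_gt0//.
rewrite mulrDr opprD expRD -/(npow e n.+1).
have h1 := expR_ge1Dx (- (e * ln (1 - n.+1%:R^-1))).
have h2 : e * ln (1 - n.+1%:R^-1) <= e * - n.+1%:R^-1.
  by rewrite ler_pM2l// le_ln1Dx// ltrN2.
have := npow_gt0 e n.+1; set a := npow e n.+1; set b := expR _ in h1 *.
move: h1 h2; set c := e * ln _; set d := n.+1%:R^-1 => h1 h2 a0; nra.
Qed.

Lemma npow_anti e m n : 0 < e -> (0 < m)%N -> (m <= n)%N -> npow e n <= npow e m.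
Proof.
move=> e_gt0 m_gt0 lemn; rewrite /npow ler_expR lerN2 ler_pM2l//.
by rewrite ler_ln ?posrE ?ltr0n ?ler_nat// (leq_trans m_gt0).
Qed.

Lemma npow_le1 e n : 0 < e -> (0 < n)%N -> npow e n <= 1.
Proof. by move=> e0 n0; rewrite -(npow1 e) npow_anti. Qed.

Lemma npow_cvg0 e eta : 0 < e -> 0 < eta ->
  exists M0, forall M, (M0 <= M)%N -> npow e M <= eta.
Proof.
move=> e_gt0 eta_gt0; pose x := expR (- ln eta / e).
exists (Num.bound x).+1 => M leM; have M_gt0 : (0 < M)%N by case: M leM.
rewrite -[leRHS]lnK ?posrE// ler_expR lerNl -ler_pdivrMl//.
have -> : e^-1 * - ln eta = ln x by rewrite /x expRK mulrC.
rewrite ler_ln ?posrE ?expR_gt0 ?ltr0n//.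
apply: le_trans (ltW (archi_boundP (expR_ge0 _))) _.
by rewrite ler_nat (leq_trans _ leM).
Qed.

Lemma npow_tail e M N : 0 < e -> (0 < M)%N ->
  \sum_(M.+1 <= n < N.+1) npow e n / n%:R <= npow e M / e.
Proof.
move=> e_gt0 M_gt0; have [leNM|ltMN] := leqP N M.
  by rewrite big_geq// divr_ge0 ?ltW// npow_gt0.
suff : \sum_(M.+1 <= n < N.+1) npow e n / n%:R <= (npow e M - npow e N) / e.
  by move/le_trans; apply; rewrite ler_pM2r ?invr_gt0// lerBlDr lerDl ltW// npow_gt0.
elim: N ltMN => // N IHN ltMN; rewrite big_nat_recr//=.
have N_gt0 : (0 < N)%N by rewrite (leq_trans M_gt0).
have h : npow e N.+1 / N.+1%:R <= (npow e N - npow e N.+1) / e.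
  by rewrite ler_pdivlMr// mulrC npow_step_ge.
move: ltMN; rewrite ltnS leq_eqVlt => /predU1P[->|ltMN].
  by rewrite big_geq// add0r.
rewrite (le_trans (lerD (IHN ltMN) h))// -mulrDl.
by rewrite addrA subrK.
Qed.

(** * Sieving a completely multiplicative function with controlled tails *)

Section Sieve.
Variables (h : nat -> R[i]) (w t : nat -> R).
Hypothesis h1 : h 1 = 1.
Hypothesis hM : forall m n, h (m * n)%N = h m * h n.
Hypothesis h_le : forall n, (0 < n)%N -> normc (h n) <= w n.
Hypothesis w_tail : forall M N, (0 < M)%N -> \sum_(M.+1 <= n < N.+1) w n <= t M.
Hypothesis t_cvg0 : forall eta : R, 0 < eta ->
  exists M0, forall M, (M0 <= M)%N -> t M <= eta.

Definition rough (s : seq nat) n := all (fun p => ~~ (p %| n)%N) s.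

Definition rough_sum s N := \sum_(1 <= n < N.+1 | rough s n) h n.

(** The terms to remove are those with n = p m, where m is at most N/p and again free of the primes
    in [s]. *)
Lemma rough_sum_cons p s N : prime p -> p \notin s -> all prime s ->
  rough_sum (p :: s) N = rough_sum s N - h p * rough_sum s (N %/ p).
Proof.
move=> p_pr pNs s_pr; rewrite /rough_sum.
have p_gt0 := prime_gt0 p_pr.
have roughM m : rough s (p * m) = rough s m.
  apply: eq_in_all => q qs; rewrite Euclid_dvdM ?(allP s_pr _ qs)//.
  rewrite dvdn_prime2 ?(allP s_pr _ qs)//; have [eqp|//] := eqVneq q p.
  by move: pNs; rewrite -eqp qs.
have sum_recr (P : pred nat) m : \sum_(1 <= n < m.+2 | P n) h n
    = \sum_(1 <= n < m.+1 | P n) h n + (if P m.+1 then h m.+1 else 0).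
  by rewrite big_mkcond big_nat_recr//= -big_mkcond.
elim: N => [|N IHN]; first by rewrite div0n !big_geq// mulr0 subr0.
rewrite !sum_recr IHN /=.
rewrite divnS//; case: (boolP (p %| N.+1)%N) => /= [/dvdnP[m Nm]|_]; last by rewrite add0n;
  ring.
have Nm' : (N %/ p = m.-1)%N.
  rewrite -[N]/(N.+1.-1) Nm; case: (m) Nm => // k _.
  by rewrite mulSn -subn1 addnC -addnBA// divnMDl// divn_small ?addn0// subn1 prednK.
have m_gt0 : (0 < m)%N by case: (m) Nm.
rewrite add1n Nm'; case: m Nm m_gt0 {Nm'} => // m Nm _; rewrite sum_recr.
rewrite Nm mulnC roughM hM; case: ifP => _; ring.
Qed.

Lemma rough_sum_tail s M N : (0 < M)%N -> (M <= N)%N ->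
  normc (rough_sum s N - rough_sum s M) <= t M.
Proof.
move=> M_gt0 leMN; rewrite /rough_sum (@big_cat_nat _ _ _ M.+1)//= addrAC subrr add0r.
rewrite (le_trans (le_normc_sum _ _ _))// (le_trans _ (w_tail N M_gt0))//.
rewrite big_mkcond !big_nat; apply: ler_sum => n /andP[ltMn _].
have := h_le (leq_trans M_gt0 (ltnW ltMn)).
by case: ifP => // _; apply: le_trans (normc_ge0 _).
Qed.

(* A finite form of the Euler product, which avoids infinite series: each prime
   removed from the sum multiplies it by [1 - h p], up to a tail. *)
Lemma sieve s eta : uniq s -> all prime s -> 0 < eta ->
  exists N0, forall N, (N0 <= N)%N ->
    normc (rough_sum s N - \prod_(p <- s) (1 - h p) * rough_sum [::] N) <= eta.
Proof.
move=> + + eta0; elim: s eta eta0 => [|p s IHs] eta eta0 /=.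
  by move=> _ _; exists 0%N => N _; rewrite big_nil mul1r subrr Normc.normc0 ltW.
move=> /andP[pNs s_uniq] /andP[p_pr s_pr].
have p_gt0 := prime_gt0 p_pr.
(* [K] bounds both |h p| and |1 - h p|, the factors of the two errors, so each error may cost
   [eta / (2 * K)]. *)
pose K := normc (h p) + normc (1 - h p) + 1.
have K0 : 0 < K by rewrite ltr_wpDl// addr_ge0// normc_ge0.
have eta20 : 0 < eta / (2 * K) by rewrite divr_gt0// mulr_gt0.
have [N0 IH] := IHs _ eta20 s_uniq s_pr; have [M0 tM] := t_cvg0 eta20.
(* The second bound puts N/p beyond [M0], so that cutting the sum at N/p instead of N costs only a
   small tail. *)
exists (maxn N0 (p * M0.+1)) => N; rewrite geq_max => /andP[leN0 leM0].
have leM : (M0.+1 <= N %/ p)%N by rewrite leq_divRL// mulnC.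
rewrite rough_sum_cons// big_cons.
set A := rough_sum s N; set B := rough_sum s (N %/ p); set P := \prod_(j <- s) _.
set T := rough_sum [::] N.
have -> : A - h p * B - (1 - h p) * P * T = (1 - h p) * (A - P * T) + h p * (A - B) by ring.
rewrite (le_trans (normcD _ _))// !Normc.normcM.
have i1 : normc (A - P * T) <= eta / (2 * K) by exact: IH.
have i2 : normc (A - B) <= eta / (2 * K).
  rewrite (le_trans (rough_sum_tail _ _ (leq_div _ _)))//; first by apply: leq_trans leM.
  exact: tM (ltnW leM).
have j1 : normc (1 - h p) <= K by rewrite /K; have := normc_ge0 (h p); lra.
have j2 : normc (h p) <= K by rewrite /K; have := normc_ge0 (1 - h p); lra.
have -> : eta = K * (eta / (2 * K)) + K * (eta / (2 * K)) by field; rewrite gt_eqF.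
by rewrite lerD// ler_pM// normc_ge0.
Qed.

(** Once all primes up to [P] are sieved out, only 1 and integers above [P] remain. The upper limit
    [N.+1] ensures that the term at 1 is present. *)
Lemma rough_sum_near1 P N : (0 < P)%N ->
  normc (rough_sum [seq p <- iota 0 P.+1 | prime p] N.+1 - 1) <= t P.
Proof.
move=> P_gt0; set s := [seq _ <- _ | _].
have rough_gt n : (1 < n)%N -> rough s n -> (P < n)%N.
  move=> n_gt1 /allP rn; rewrite ltnNge; apply/negP => lenP.
  have /rn : pdiv n \in s.
    by rewrite mem_filter pdiv_prime// mem_iota/= add0n ltnS (leq_trans (pdiv_leq (ltnW
      n_gt1))).
  by rewrite pdiv_dvd.
rewrite /rough_sum big_mkcond big_ltn//= h1.
have -> : rough s 1.
  by apply/allP => p; rewrite mem_filter => /andP[p_pr _]; rewrite dvdn1 gtn_eqF// prime_gt1.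
rewrite addrAC subrr add0r (le_trans (le_normc_sum _ _ _))//.
have le0 n : (1 <= n)%N -> 0 <= w n by move/h_le; apply: le_trans (normc_ge0 _).
have [leNP|ltPN] := leqP N.+1 P.
  rewrite big_nat big1 => [|n /andP[n1 n2]].
    by rewrite (le_trans _ (w_tail P P_gt0))// big_geq.
  by case: ifP => [/(rough_gt _ n1)|_]; [lia|rewrite Normc.normc0].
rewrite (@big_cat_nat _ _ _ P.+1)//= ?ltnS ?(ltnW ltPN)// big_nat big1 ?add0r =>
  [|n /andP[n1 n2]].
  rewrite (le_trans _ (w_tail N.+1 P_gt0))// !big_nat; apply: ler_sum => n /andP[n1 n2].
  by case: ifP => _; rewrite ?Normc.normc0 ?h_le ?le0//; lia.
by case: ifP => [/(rough_gt _ n1)|_]; [lia|rewrite Normc.normc0].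
Qed.

(** The sieved sum is within 1/4 of 1 by the tail bound and within 1/4 of the product by the
    sieve. *)
Lemma euler_product_lower : exists P0, forall P, (P0 <= P)%N ->
  exists N0, forall N, (N0 <= N)%N ->
  2^-1 <= (\prod_(p <- [seq p <- iota 0 P.+1 | prime p]) normc (1 - h p))
           * normc (\sum_(1 <= n < N.+1) h n).
Proof.
have q0 : 0 < 4^-1 :> R by rewrite invr_gt0.
have [M0 tM] := t_cvg0 q0; exists M0.+1 => P leP.
set s := [seq _ <- _ | _].
have s_uniq : uniq s by rewrite filter_uniq ?iota_uniq.
have s_pr : all prime s by exact: filter_all.
have [N0 sv] := sieve s_uniq s_pr q0.
exists N0.+1 => -[//|N] leN; have {sv} := sv _ (ltnW leN).
have := rough_sum_near1 N (leq_trans (ltn0Sn _) leP); rewrite -/s.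
have := tM _ (ltnW leP).
rewrite -normc_prod -Normc.normcM /(rough_sum [::]).
set A := rough_sum s N.+1; set B := _ * _ => i1 i2 i3.
have : normc 1 <= normc (1 - A) + normc (A - B) + normc B.
  rewrite {1}(_ : 1 = (1 - A) + (A - B) + B); last by ring.
  by rewrite (le_trans (normcD _ _))// lerD2r normcD.
rewrite Normc.normc1 (normcB 1); lra.
Qed.

End Sieve.

End EulerProduct.

(** * Non-vanishing at 1 *)

Section NonVanishing.
Import Order.TTheory GRing.Theory Num.Theory.
Local Open Scope ring_scope.
Local Open Scope complex_scope.

Variable R : realType.
Implicit Types (e : R) (n : nat) (z : R[i]).
Local Notation normc := (@Normc.normc R).

Lemma normc_sqr (a b : R) : normc (a +i* b) ^+ 2 = a ^+ 2 + b ^+ 2.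
Proof. by rewrite /= sqr_sqrtr// addr_ge0 ?sqr_ge0. Qed.

(** The 3-4-1 inequality for a single Euler factor, with r = p^(-s) and z a character value,
    obtained without logarithms. *)
Lemma euler_factor_le1 (r : R) z : 0 <= r <= 1 -> normc z = 1 ->
  (1 - r) ^+ 3 * normc (1 - r%:C * z) ^+ 4 * normc (1 - r%:C * z ^+ 2) <= 1.
Proof.
case: z => a b /andP[r0 r1] /(congr1 (fun x => x ^+ 2)); rewrite normc_sqr expr1n => ab.
have b2 : b ^+ 2 = 1 - a ^+ 2 by lra.
have n1 : normc (1 - r%:C * (a +i* b)) ^+ 2 = 1 + r ^+ 2 - 2 * r * a.
  have -> : 1 - r%:C * (a +i* b) = (1 - r * a) +i* (- (r * b)).
    by apply/eqP; rewrite eq_complex /= !mul0r subr0 addr0 sub0r !eqxx.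
  by rewrite normc_sqr sqrrN exprMn b2; ring.
have n2 : normc (1 - r%:C * (a +i* b) ^+ 2) ^+ 2 = (1 - r) ^+ 2 + 4 * r * (1 - a ^+ 2).
  have -> : 1 - r%:C * (a +i* b) ^+ 2 = (1 - r * (a ^+ 2 - b ^+ 2)) +i* (- (r * (2 * a * b))).
    apply/eqP; rewrite eq_complex expr2 /= !mul0r subr0 addr0 sub0r.
    by apply/andP; split; apply/eqP; ring.
  by rewrite normc_sqr sqrrN !exprMn b2; ring.
have d0 := normc_ge0 (1 - r%:C * (a +i* b) ^+ 2).
pose d : R := normc (1 - r%:C * (a +i* b) ^+ 2); rewrite -/d in n2 d0 *.
pose m : R := normc (1 - r%:C * (a +i* b)); rewrite -/m in n1 *.
have a2 : a ^+ 2 <= 1 by have := sqr_ge0 b; lra.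
pose D := 1 + r ^+ 2 - 2 * r * a ^+ 2.
(* AM-GM for [(1 - r) ^ 2] and [d ^ 2], whose sum is [2 D] *)
have dD : (1 - r) * d <= D.
  have D0 : 0 <= D.
    have ra2 : r * a ^+ 2 <= r * 1 by rewrite ler_wpM2l.
    by rewrite /D; have := sqr_ge0 (1 - r); nra.
  have u2 : ((1 - r) * d) ^+ 2 = D ^+ 2 - (2 * r * (1 - a ^+ 2)) ^+ 2.
    by rewrite exprMn n2 /D; ring.
  have rd0 : 0 <= (1 - r) * d by rewrite mulr_ge0 ?subr_ge0.
  rewrite -ler_sqr ?nnegrE//.
  by have := sqr_ge0 (2 * r * (1 - a ^+ 2)); lra.
(* Since [2 p + D <= 3], we get [p ^ 2 D <= p ^ 2 (3 - 2 p) <= 1]. *)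
pose p := (1 - r) * m ^+ 2.
have p0 : 0 <= p by rewrite mulr_ge0 ?subr_ge0// sqr_ge0.
have pD : 2 * p + D <= 3.
  rewrite -subr_ge0.
  have -> : 3 - (2 * p + D) = r ^+ 2 + 2 * r * ((1 - r) + a) ^+ 2 by rewrite /p n1 /D; ring.
  by rewrite addr_ge0 ?sqr_ge0// mulr_ge0 ?sqr_ge0// mulr_ge0.
rewrite [leLHS](_ : _ = p ^+ 2 * ((1 - r) * d)); last by rewrite /p; ring.
apply: (@le_trans _ _ (p ^+ 2 * (3 - 2 * p))).
  by rewrite ler_wpM2l ?sqr_ge0//; lra.
rewrite -subr_ge0 (_ : _ - _ = (1 - p) ^+ 2 * (1 + 2 * p)); last by ring.
by rewrite mulr_ge0 ?sqr_ge0//; lra.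
Qed.

Lemma abel_sum (b : nat -> R[i]) (v : nat -> R) N :
  \sum_(1 <= n < N.+1) b n * (v n)%:C =
  (\sum_(1 <= n < N.+1) b n) * (v N.+1)%:C +
  \sum_(1 <= n < N.+1) (\sum_(1 <= k < n.+1) b k) * (v n - v n.+1)%:C.
Proof.
elim: N => [|N IHN]; first by rewrite !big_geq// mul0r addr0.
rewrite [LHS]big_nat_recr// IHN/= ![in RHS](big_nat_recr N.+1)//=.
by rewrite !(rmorphB (real_complex R))/=; ring.
Qed.

Lemma abel_sum_le (b : nat -> R[i]) (v S : nat -> R) N :
  (forall n, 0 <= v n) -> (forall n, (0 < n)%N -> v n.+1 <= v n) ->
  (forall n, (0 < n)%N -> normc (\sum_(1 <= k < n.+1) b k) <= S n) -> (0 < N)%N ->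
  normc (\sum_(1 <= n < N.+1) b n * (v n)%:C) <=
    S N * v N.+1 + \sum_(1 <= n < N.+1) S n * (v n - v n.+1).
Proof.
move=> v0 vanti hS N0; rewrite abel_sum (le_trans (normcD _ _))// Normc.normcM normc_real.
rewrite ger0_norm// lerD ?ler_wpM2r ?hS// (le_trans (le_normc_sum _ _ _))//.
rewrite !big_nat; apply: ler_sum => n /andP[n0 _].
rewrite Normc.normcM normc_real ger0_norm ?subr_ge0 ?vanti//.
by rewrite ler_wpM2r ?hS// subr_ge0 vanti.
Qed.

Lemma sum_inv_sqr_le2 N : \sum_(1 <= n < N.+1) (n%:R^-1 * n%:R^-1 : R) <= 2.
Proof.
case: N => [|N]; first by rewrite big_geq.
(* The subtracted 1/(N + 1) makes the bound inductive. *)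
suff : \sum_(1 <= n < N.+2) (n%:R^-1 * n%:R^-1 : R) <= 2 - N.+1%:R^-1.
  by move/le_trans; apply; rewrite gerBl invr_ge0 ler0n.
elim: N => [|N IHN]; first by rewrite big_nat1 !invr1 mulr1; lra.
rewrite big_nat_recr//= (le_trans (lerD IHN (lexx _)))//.
have a0 : 0 < N.+1%:R :> R by rewrite ltr0n.
rewrite -[N.+2%:R]natr1; set a := N.+1%:R in a0 *.
rewrite -subr_ge0 (_ : _ - _ = (a * (a + 1) ^+ 2)^-1); last by field; rewrite !gt_eqF//; lra.
by rewrite invr_ge0 mulr_ge0 ?sqr_ge0// ltW.
Qed.

(** * The contradiction from a zero of L(s, chi) at s = 1 *)

Section LOne.
Variables (chi : nat -> R[i]) (B c : R).
Hypothesis chi1 : chi 1 = 1.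
Hypothesis chiM : forall m n, chi (m * n)%N = chi m * chi n.
Hypothesis chi_norm : forall n, chi n = 0 \/ normc (chi n) = 1.
Hypothesis sum_chi2 : forall N, normc (\sum_(1 <= n < N.+1) chi n ^+ 2) <= B.
(* [L(1, chi) = 0], with the rate of convergence of the partial sums *)
Hypothesis sum_chi_div : forall N, (0 < N)%N ->
  normc (\sum_(1 <= n < N.+1) chi n * n%:R^-1%:C) <= c / N%:R.

Let B_ge0 : 0 <= B.
Proof. exact: le_trans (normc_ge0 _) (sum_chi2 0). Qed.

Let c_ge0 : 0 <= c.
Proof.
by have := sum_chi_div (isT : 0 < 1)%N; move/(le_trans (normc_ge0 _)); rewrite divr1.
Qed.

Let chi_le1 n : normc (chi n) <= 1.
Proof. by case: (chi_norm n) => ->; rewrite ?Normc.normc0. Qed.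

Let w e n : R := npow e n / n%:R.

Let w_ge0 e n : 0 <= w e n.
Proof. by rewrite divr_ge0 ?ler0n// ltW ?npow_gt0. Qed.

Let w1 e : w e 1 = 1. Proof. by rewrite /w npow1 divr1. Qed.

Let w_anti e n : 0 < e -> (0 < n)%N -> w e n.+1 <= w e n.
Proof.
move=> e0 n0; rewrite ler_pM ?invr_ge0 ?ler0n ?npow_anti ?(ltW (npow_gt0 _ _))//.
by rewrite lef_pV2 ?posrE ?ltr0n// ler_nat.
Qed.

Let w_le1 e n : 0 < e -> (0 < n)%N -> w e n <= 1.
Proof.
move=> e0 n0; rewrite /w ler_pdivrMr ?ltr0n// mul1r (le_trans (npow_le1 e0 n0))//.
by rewrite ler1n.
Qed.

Let twist e (f : nat -> R[i]) n := f n * (w e n)%:C.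

Let twist_lower e (f : nat -> R[i]) : 0 < e -> f 1 = 1 ->
  (forall m n, f (m * n)%N = f m * f n) -> (forall n, normc (f n) <= 1) ->
  exists P0, forall P, (P0 <= P)%N -> exists N0, forall N, (N0 <= N)%N ->
  2^-1 <= (\prod_(p <- [seq p <- iota 0 P.+1 | prime p]) normc (1 - twist e f p))
           * normc (\sum_(1 <= n < N.+1) twist e f n).
Proof.
move=> e0 f1 fM f_le.
apply: (@euler_product_lower _ (twist e f) (w e) (fun n => npow e n / e)).
- by rewrite /twist f1 w1 mulr1.
- case=> [|m] [|n]; rewrite /twist ?muln0 ?mul0n.
  + by rewrite -[0%N in LHS](muln0 0) fM /w mulr0n invr0 !mulr0.
  + by rewrite /w mulr0n invr0 !mulr0 mul0r.
  + by rewrite /w mulr0n invr0 !mulr0.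
  + rewrite fM /w npowM// natrM invfM [X in X%:C](_ : _ = npow e m.+1 / m.+1%:R * (npow e
      n.+1 / n.+1%:R)).
      by rewrite (rmorphM (real_complex R))/=; ring.
    by ring.
- move=> n n0; rewrite /twist Normc.normcM normc_real ger0_norm//.
  by rewrite ler_piMl.
- by move=> M N; exact: npow_tail.
- move=> eta eta0; have [|M0 hM] := @npow_cvg0 R e (eta * e) e0; first by rewrite mulr_gt0.
  by exists M0 => M /hM; rewrite ler_pdivrMr.
Qed.

(** The principal character, which plays the part of zeta in the 3-4-1 inequality. *)
Let chi0 n : R[i] := if chi n == 0 then 0 else 1.

Let chi0M m n : chi0 (m * n) = chi0 m * chi0 n.
Proof.
rewrite /chi0 chiM mulf_eq0.
by case: eqP => _; case: eqP => _; rewrite ?mul0r ?mul1r.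
Qed.

Let twist0_le e N : 0 < e -> normc (\sum_(1 <= n < N.+1) twist e chi0 n) <= 1 + e^-1.
Proof.
move=> e0; rewrite (le_trans (le_normc_sum _ _ _))//.
apply: (@le_trans _ _ (\sum_(1 <= n < N.+1) w e n)).
  apply: ler_sum => n _; rewrite Normc.normcM normc_real ger0_norm// ler_piMl//.
  by rewrite /chi0; case: ifP; rewrite ?Normc.normc0 ?Normc.normc1.
case: N => [|N]; first by rewrite big_geq// addr_ge0 ?invr_ge0 ?ltW.
by rewrite big_ltn// w1 lerD2l (le_trans (npow_tail _ _ _))// npow1 mul1r.
Qed.

(** Partial summation: the weights decrease from 1, so the bound [B] on the sums of chi^2 survives
    the weighting. *)
Let twist2_le e N : 0 < e -> (0 < N)%N ->
  normc (\sum_(1 <= n < N.+1) twist e (fun n => chi n ^+ 2) n) <= B.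
Proof.
move=> e0 N0.
rewrite (le_trans (@abel_sum_le _ _ (fun=> B) _ _ _ _ _))// => [n n0|]; first exact: w_anti.
have tel : \sum_(1 <= n < N.+1) (w e n - w e n.+1) = w e 1 - w e N.+1.
  rewrite -opprB -telescope_sumr// -sumrN.
  by apply: eq_bigr => n _; rewrite opprB.
by rewrite -mulr_sumr -mulrDr tel w1 addrCA subrr addr0 mulr1.
Qed.

(** Partial summation of chi(n)/n against n^(-e): the differences of the latter are at most e/n, so
    the main sum is at most c e times the sum of 1/n^2. The boundary term is at most c/N, hence at
    most c e. *)
Let twist1_le e N : 0 < e -> (0 < N)%N -> e^-1 <= N%:R ->
  normc (\sum_(1 <= n < N.+1) twist e chi n) <= 3 * c * e.
Proof.
move=> e0 N0 leN.
have -> : \sum_(1 <= n < N.+1) twist e chi n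
  = \sum_(1 <= n < N.+1) (chi n * n%:R^-1%:C) * (npow e n)%:C.
  by apply: eq_bigr => n _; rewrite /twist /w (rmorphM (real_complex R))/=; ring.
rewrite (le_trans (@abel_sum_le _ _ (fun n => c / n%:R) _ _ _ sum_chi_div N0))//.
- by move=> n; rewrite ltW ?npow_gt0.
- by move=> n n0; exact: npow_anti.
have h1 : c / N%:R * npow e N.+1 <= c * e.
  rewrite -[leRHS]mulr1 ler_pM ?mulr_ge0 ?invr_ge0 ?ler0n ?npow_le1 ?(ltW (npow_gt0 _ _))//.
  by rewrite ler_wpM2l// -[e]invrK lef_pV2 ?posrE ?invr_gt0 ?ltr0n.
have h2 : \sum_(1 <= n < N.+1) c / n%:R * (npow e n - npow e n.+1) <= c * e * 2.
  apply: le_trans (ler_wpM2l (mulr_ge0 c_ge0 (ltW e0)) (sum_inv_sqr_le2 N)).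
  rewrite mulr_sumr !big_nat; apply: ler_sum => n /andP[n0 _].
  rewrite (_ : _ * (_ * _) = c / n%:R * (e * n%:R^-1)); last by ring.
  rewrite ler_wpM2l ?divr_ge0// (le_trans (npow_step_le e0 n0))// ler_pM2l//.
  by rewrite ler_piMl ?invr_ge0 ?ler0n// npow_le1.
lra.
Qed.

(** The sums for [chi0], [chi] and chi^2 are O(1/e), O(e) and O(1), so the product of their powers
    3, 4 and 1 is O(e). The Euler products and the 3-4-1 inequality bound it below by 2^(-8). *)
Lemma L_one_neq0 : False.
Proof.
have cB0 : 0 <= c ^+ 4 * B by rewrite mulr_ge0 ?exprn_ge0.
(* Here 256 = 2^8 comes from the eight lower bounds 1/2, and 648 = 2^3 * 3^4 from the upper bounds
   2/e and 3 c e. The added 1 keeps [K] positive and the final inequality strict. *)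
pose K := 256 * 648 * (c ^+ 4 * B + 1).
have K0 : 0 < K by rewrite /K; lra.
pose e := K^-1; have e0 : 0 < e by rewrite invr_gt0.
have e1 : 1 <= e^-1 by rewrite invrK /K; lra.
have eK : e * K = 1 by rewrite mulVf// gt_eqF.
have [|||P0 H0] := @twist_lower e chi0 e0; [| exact: chi0M | |].
- by rewrite /chi0 chi1 oner_eq0.
- by move=> n; rewrite /chi0; case: ifP; rewrite ?Normc.normc0 ?Normc.normc1.
have [P1 H1] := twist_lower e0 chi1 chiM chi_le1.
have [|||P2 H2] := @twist_lower e (fun n => chi n ^+ 2) e0.
- by rewrite chi1 expr1n.
- by move=> m n; rewrite chiM exprMn.
- by move=> n; rewrite normcX exprn_ile1 ?normc_ge0.
pose P := maxn P0 (maxn P1 P2).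
have [N0 {}H0] := H0 P (leq_maxl _ _).
have [N1 {}H1] := H1 P (leq_trans (leq_maxl P1 P2) (leq_maxr _ _)).
have [N2 {}H2] := H2 P (leq_trans (leq_maxr P1 P2) (leq_maxr _ _)).
pose N := maxn (maxn N0 (maxn N1 N2)) (Num.bound e^-1).+1.
have N_gt0 : (0 < N)%N by rewrite leq_max orbT.
have leN : e^-1 <= N%:R.
  rewrite (le_trans (ltW (archi_boundP _)))// ?(le_trans _ e1)//.
  by rewrite ler_nat leq_max leqnSn orbT.
have {}H0 := H0 N _; have {}H1 := H1 N _; have {}H2 := H2 N _.
have {}H0 : 2^-1 <= _ := H0 ltac:(by rewrite !leq_max leqnn).
have {}H1 : 2^-1 <= _ := H1 ltac:(by rewrite !leq_max leqnn ?orbT).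
have {}H2 : 2^-1 <= _ := H2 ltac:(by rewrite !leq_max leqnn ?orbT).
have t0 := twist0_le N e0; have t1 := twist1_le e0 N_gt0 leN; have t2 := twist2_le e0 N_gt0.
move: H0 H1 H2; set s := [seq _ <- _ | _].
set X0 := normc (\sum_(1 <= n < N.+1) twist e chi0 n) in t0 *.
set X1 := normc (\sum_(1 <= n < N.+1) twist e chi n) in t1 *.
set X2 := normc (\sum_(1 <= n < N.+1) twist e (fun n => chi n ^+ 2) n) in t2 *.
set Q0 := \prod_(p <- s) _; set Q1 := \prod_(p <- s) _; set Q2 := \prod_(p <- s) _.
move=> H0 H1 H2.
(* The inequality holds prime by prime; where chi vanishes, all three factors are 1. *)
have Q_le1 : Q0 ^+ 3 * Q1 ^+ 4 * Q2 <= 1.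
  suff : 0 <= Q0 ^+ 3 * Q1 ^+ 4 * Q2 <= 1 by case/andP.
  rewrite /Q0 /Q1 /Q2 -!prodrXl -!big_split big_seq /=.
  apply: (big_ind (fun x => 0 <= x <= 1)) => [|x y /andP[x0 x1] /andP[y0 y1]|p]; last 1 first.
  - rewrite mem_filter => /andP[/prime_gt0 p0 _].
    apply/andP; split; first by rewrite !mulr_ge0 ?exprn_ge0 ?normc_ge0.
    rewrite /twist /chi0; case: (chi_norm p) => [->|chip1].
      by rewrite eqxx expr2 !mul0r !subr0 Normc.normc1 !expr1n !mulr1.
    have /negPf -> : chi p != 0.
      by apply: contra_eq_neq chip1 => ->; rewrite Normc.normc0 eq_sym oner_eq0.
    rewrite mul1r ![_ * (w e p)%:C]mulrC.
    have -> : normc (1 - (w e p)%:C) = 1 - w e p.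
      by rewrite -(rmorphB (real_complex R) 1) normc_real ger0_norm// subr_ge0 w_le1.
    by apply: euler_factor_le1; rewrite ?w_ge0 ?w_le1.
  - by rewrite ler01 lexx.
  - by rewrite mulr_ge0//= mulr_ile1.
have X0K : X0 <= 2 / e by rewrite (le_trans t0)// mulr_natl mulr2n lerD2r.
have i : 2^-1 ^+ 3 * 2^-1 ^+ 4 * 2^-1 <=
    (Q0 * X0) ^+ 3 * (Q1 * X1) ^+ 4 * (Q2 * X2).
  have h0 : 0 <= 2^-1 :> R by rewrite invr_ge0.
  by rewrite !ler_pM ?mulr_ge0 ?exprn_ge0 ?lerXn2r ?nnegrE ?(le_trans h0).
have j : X0 ^+ 3 * X1 ^+ 4 * X2 <= (2 / e) ^+ 3 * (3 * c * e) ^+ 4 * B.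
  have [x0 x1 x2] : [/\ 0 <= X0, 0 <= X1 & 0 <= X2] by rewrite !normc_ge0.
  by rewrite !ler_pM ?mulr_ge0 ?exprn_ge0 ?lerXn2r ?nnegrE ?mulr_ge0 ?invr_ge0 ?(ltW e0).
have k : (Q0 * X0) ^+ 3 * (Q1 * X1) ^+ 4 * (Q2 * X2) <= X0 ^+ 3 * X1 ^+ 4 * X2.
  rewrite (_ : _ * _ = (Q0 ^+ 3 * Q1 ^+ 4 * Q2) * (X0 ^+ 3 * X1 ^+ 4 * X2)); last by ring.
  by rewrite ler_piMl// !mulr_ge0 ?exprn_ge0 ?normc_ge0.
have l : (2 / e) ^+ 3 * (3 * c * e) ^+ 4 * B = 648 * (c ^+ 4 * B) * e.
  by field; rewrite gt_eqF.
move: (le_trans i (le_trans k j)); rewrite l.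
have : 648 * (c ^+ 4 * B) * e <= e * K / 256 - 648 * e by rewrite /K; lra.
rewrite eK; lra.
Qed.
End LOne.
End NonVanishing.

(** * The Fourier series of the sawtooth *)

Section Sawtooth.
Import Order.TTheory GRing.Theory Num.Theory.
Import numFieldNormedType.Exports.
Local Open Scope ring_scope.

Variable R : realType.
Implicit Types (a t : R) (n N : nat).

Lemma is_derive_sin_mul a t : is_derive t 1 (fun t : R => sin (a * t)) (a * cos (a * t)).
Proof.
rewrite mulrC; apply: (@is_derive1_comp R sin (fun t => a * t)).
by have := @is_deriveZ R R R id a t 1 1 _; rewrite /GRing.scale/= mulr1; apply.
Qed.

Lemma is_derive_cos_mul a t : is_derive t 1 (fun t : R => cos (a * t)) (- (a * sin (a * t))).
Proof.
rewrite mulrC -mulNr; apply: (@is_derive1_comp R cos (fun t => a * t)).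
by have := @is_deriveZ R R R id a t 1 1 _; rewrite /GRing.scale/= mulr1; apply.
Qed.

Definition sin_sum N t : R := \sum_(1 <= n < N.+1) sin (n%:R * t) * n%:R^-1.

Lemma is_derive_sin_sum N t :
  is_derive t 1 (sin_sum N) (\sum_(1 <= n < N.+1) cos (n%:R * t)).
Proof.
elim: N => [|N IHN].
  rewrite big_geq// (_ : sin_sum 0 = cst 0); first exact: is_derive_cst.
  by apply/funext => x; rewrite /sin_sum big_geq.
rewrite big_nat_recr//=.
have -> : sin_sum N.+1 = sin_sum N + (N.+1%:R^-1 *: (fun t : R => sin (N.+1%:R * t))).
  by apply/funext => x; rewrite /sin_sum big_nat_recr//= mulrC.
apply: is_deriveD.
have := is_deriveZ (N.+1%:R^-1) (is_derive_sin_mul N.+1%:R t).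
by rewrite /GRing.scale/= mulKf// pnatr_eq0.
Qed.

(** Each step is the identity 2 sin(t/2) cos(nt) = sin((n + 1/2)t) - sin((n - 1/2)t). *)
Lemma dirichlet_kernel N t :
  2 * sin (2^-1 * t) * (\sum_(1 <= n < N.+1) cos (n%:R * t) + 2^-1)
  = sin ((N%:R + 2^-1) * t).
Proof.
elim: N => [|N IHN]; first by rewrite big_geq// !add0r; field.
rewrite big_nat_recr//= addrAC mulrDr IHN -[N.+1%:R]natr1.
have -> : (N%:R + 2^-1) * t = (N%:R + 1) * t - 2^-1 * t by field.
have -> : (N%:R + 1 + 2^-1) * t = (N%:R + 1) * t + 2^-1 * t by field.
by rewrite sinB sinD; ring.
Qed.

(* The error of the partial sum, corrected by an explicit term O(1/N) so that its
   derivative becomes O(1/N) too; it vanishes at [pi]. *)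
Let G N t : R := sin_sum N t - 2^-1 * (pi - t)
  + (2 * N%:R + 1)^-1 * (cos ((N%:R + 2^-1) * t) * (sin (2^-1 * t))^-1).

Let dG N t : R := - (2 * (2 * N%:R + 1))^-1 *
   (cos ((N%:R + 2^-1) * t) * cos (2^-1 * t) * (sin (2^-1 * t))^-2).

(** The derivatives of the sine sum and of the linear term add up to the Dirichlet kernel.
    Differentiating the cosine in the correction cancels it and leaves [dG]. *)
Let is_derive_G N t : sin (2^-1 * t) != 0 -> is_derive t 1 (G N) (dG N t).
Proof.
move=> s0.
have d1 := is_derive_sin_sum N t.
have d2 : is_derive t 1 (2^-1 *: (cst pi - id : R -> R)) (2^-1 *: (0 - 1)).
  by apply: is_deriveZ; apply: is_deriveB.
have d3 := is_derive_cos_mul (N%:R + 2^-1) t.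
have d4 := is_deriveV s0 (is_derive_sin_mul 2^-1 t).
have := is_deriveD (is_deriveB d1 d2) (is_deriveZ (2 * N%:R + 1)^-1 (is_deriveM d3 d4)).
have -> : sin_sum N - 2^-1 *: (cst pi - id) + (2 * N%:R + 1)^-1 *:
   ((fun t : R => cos ((N%:R + 2^-1) * t)) * (fun y => (sin (2^-1 * y))^-1)) = G N.
  by apply/funext => x.
move=> H; apply: (is_derive_eq H); rewrite /dG /GRing.scale/=.
have := dirichlet_kernel N t => K.
have -> : \sum_(1 <= n < N.+1) cos (n%:R * t) =
   (2 * sin (2^-1 * t))^-1 * sin ((N%:R + 2^-1) * t) - 2^-1.
  by rewrite -K mulKf ?addrK// mulf_neq0 ?pnatr_eq0.
have N0 : 2 * N%:R + 1 != 0 :> R by rewrite gt_eqF// ltr_wpDl// mulr_ge0.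
by field; rewrite s0 N0.
Qed.

Lemma cos_natS_half N : cos ((N%:R + 2^-1) * pi) = 0 :> R.
Proof.
have -> : (N%:R + 2^-1) * pi = pi / 2 + pi *+ N :> R by rewrite -mulr_natl; field.
elim: N => [|N IHN].
  by rewrite mulr0n addr0 cos_pihalf.
by rewrite [pi *+ _]mulrSr addrA cosDpi IHN oppr0.
Qed.

Lemma sin_nat_pi N : sin (N%:R * pi) = 0 :> R.
Proof.
rewrite mulr_natl; elim: N => [|N IHN]; first by rewrite mulr0n sin0.
by rewrite mulrSr sinDpi IHN oppr0.
Qed.

Let G_pi N : G N pi = 0.
Proof.
rewrite /G subrr mulr0 subr0 cos_natS_half mul0r mulr0 addr0 /sin_sum big1// => n _.
by rewrite sin_nat_pi mul0r.
Qed.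

Lemma sawtooth_pi t : 0 < t <= pi -> exists c : R, forall N, (0 < N)%N ->
  `|sin_sum N t - 2^-1 * (pi - t)| <= c / N%:R.
Proof.
move=> /andP[t0 tpi]; have pi0 := pi_gt0 R.
pose s : R := sin (2^-1 * t).
have s0 : 0 < s by apply: sin_gt0_pi; lra.
have s_le x : t <= x <= pi -> s <= sin (2^-1 * x).
  move=> /andP[tx xpi]; rewrite /s leNgt ltr_sin ?in_itv/=; lra.
have invs x : t <= x <= pi -> (sin (2^-1 * x))^-1 <= s^-1.
  by move=> /s_le h; rewrite lef_pV2 ?posrE// (lt_le_trans s0).
(* The first term comes from the mean value theorem for [G] on [t, pi], where sin(x/2) >= s; the
   second bounds the correction in [G] itself. *)
exists (pi * s^-1 ^+ 2 + s^-1) => N N0.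
have NR : 0 < N%:R :> R by rewrite ltr0n.
have /andP[N1 N1'] : 0 < (2 * N%:R + 1 : R)^-1 <= N%:R^-1.
  by rewrite invr_gt0 lef_pV2 ?posrE; lra.
have hG : `|G N t| <= pi * s^-1 ^+ 2 / N%:R.
  have [||c /itvP c_in] := @MVT_segment R (G N) (dG N) t pi tpi.
  - move=> x /itvP x_in; apply: is_derive_G.
    by rewrite gt_eqF// (lt_le_trans s0)// s_le// !x_in.
  - apply: derivable_within_continuous => x /itvP x_in.
    suff [] : is_derive x 1 (G N) (dG N x) by [].
    apply: is_derive_G.
    by rewrite gt_eqF// (lt_le_trans s0)// s_le// !x_in.
  rewrite G_pi sub0r => eG; rewrite -normrN eG normrM mulrC.
  have cs : t <= c <= pi by rewrite !c_in.
  have sc : 0 < sin (2^-1 * c) by rewrite (lt_le_trans s0)// s_le.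
  have : `|dG N c| <= N%:R^-1 * s^-1 ^+ 2.
    rewrite /dG !normrM normrN.
    rewrite ler_pM ?mulr_ge0//.
      rewrite ger0_norm ?invr_ge0 ?lef_pV2 ?posrE; lra.
    rewrite -[leRHS]mul1r ler_pM ?mulr_ge0//.
      by rewrite mulr_ile1// cos_max.
    rewrite ger0_norm ?invr_ge0 ?sqr_ge0// -exprVn.
    by rewrite lerXn2r ?nnegrE ?invr_ge0 ?invs// ltW.
  have : `|pi - t| <= pi by rewrite ger0_norm; lra.
  move=> h1 h2; rewrite -mulrA [s^-1 ^+ 2 * _]mulrC.
  by rewrite ler_pM.
have h2 : `|(2 * N%:R + 1)^-1 * (cos ((N%:R + 2^-1) * t) * s^-1)| <= s^-1 / N%:R.
  rewrite !normrM mulrC ler_pM ?mulr_ge0//; last by rewrite ger0_norm// ltW.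
  have s'0 : 0 <= s^-1 by rewrite invr_ge0 ltW.
  by rewrite (ger0_norm s'0) ler_piMl ?cos_max.
rewrite mulrDl (le_trans _ (lerD hG h2))// (le_trans _ (ler_normB _ _))//.
by rewrite /G addrK.
Qed.

(** Both the sine sum and (pi - t)/2 change sign under t -> 2 pi - t, which reduces the second half
    of the period to the first. *)
Lemma sawtooth t : 0 < t < 2 * pi -> exists c : R, forall N, (0 < N)%N ->
  `|sin_sum N t - 2^-1 * (pi - t)| <= c / N%:R.
Proof.
move=> /andP[t0 t2]; have [tpi|tpi] := leP t pi; first by apply: sawtooth_pi; rewrite t0.
have [|c hc] := @sawtooth_pi (2 * pi - t); first by lra.
exists c => N N0; have := hc N N0.
suff -> : sin_sum N (2 * pi - t) = - sin_sum N t.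
  rewrite [X in `|X| <= _](_ : _ = - (sin_sum N t - 2^-1 * (pi - t))) ?normrN//.
  by field.
rewrite /sin_sum -sumrN; apply: eq_bigr => n _; rewrite -mulNr; congr (_ * _).
have -> : n%:R * (2 * pi - t) = - (n%:R * t) + (pi *+ 2) *+ n :> R.
  by rewrite -[_ *+ n]mulr_natl -[pi *+ 2]mulr_natl; ring.
by rewrite (periodicn (@sinD2pi R)) sinN.
Qed.
End Sawtooth.

(** * First moments of odd characters *)

Section FpFacts.
Import Order.TTheory GRing.Theory Num.Theory.
Local Open Scope ring_scope.

Lemma sum_char_eq0 (C : idomainType) (l : nat) (chi : 'F_l -> C) :
  (forall x y, chi (x * y) = chi x * chi y) ->
  forall y, y != 0 -> chi y != 1 -> \sum_x chi x = 0.
Proof.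
move=> chiM y y0 cy; have : chi y * \sum_x chi x = \sum_x chi x.
  rewrite mulr_sumr [RHS](reindex_inj (mulfI y0)).
  by apply: eq_bigr => x _; rewrite chiM.
move/eqP; rewrite -subr_eq0 -{2}[\sum_x _]mul1r -mulrBl mulf_eq0 subr_eq0 (negPf cy).
by move/eqP.
Qed.

Variables (l : nat) (l_pr : prime l).

Lemma big_Fp (T : Type) (idx : T) (op : Monoid.law idx) (F : nat -> T) :
  \big[op/idx]_(x : 'F_l) F (val x) = \big[op/idx]_(0 <= i < l) F i.
Proof. by rewrite -[in RHS](Fp_cast l_pr) big_mkord. Qed.

Lemma Fp_Fermat (x : 'F_l) : x != 0 -> x ^+ l.-1 = 1.
Proof.
move=> x0; have P0 : \prod_(y : 'F_l | y != 0) y != 0 by apply/prodf_neq0.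
apply: (mulIf P0); rewrite mul1r [RHS](reindex_inj (mulfI x0)) /=.
rewrite [RHS](eq_bigl (fun y => y != 0)) => [|y].
  rewrite big_split prodr_const /=; congr (_ ^+ _ * _).
  by rewrite (eq_card (_ : _ =i predC1 0)) ?cardC1 ?card_Fp.
by rewrite mulf_eq0 (negPf x0).
Qed.

Lemma Fp_generator : exists2 g : 'F_l, l.-1.-primitive_root g &
  forall x, x != 0 -> exists i, x = g ^+ i.
Proof.
have l1 : (0 < l.-1)%N by rewrite -subn1 subn_gt0 prime_gt1.
pose rs := [seq x <- enum 'F_l | x != 0].
have szrs : size rs = l.-1.
  have -> : l.-1 = #|'F_l|.-1 by rewrite card_Fp.
  rewrite -(cardC1 (0 : 'F_l)) cardE; congr size.
  by rewrite /rs enumT; apply: eq_filter => x; rewrite !inE.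
have urs : uniq rs by apply: filter_uniq; exact: enum_uniq.
have /hasP[g _ g_prim] : has l.-1.-primitive_root rs.
  apply: has_prim_root; rewrite ?szrs ?urs//.
  by apply/allP => x; rewrite mem_filter => /andP[x0 _]; apply/unity_rootP/Fp_Fermat.
exists g => // x x0; have [i -> //] := prim_rootP g_prim (Fp_Fermat x0).
by exists i.
Qed.

End FpFacts.

Section OddCharacter.
Import Order.TTheory GRing.Theory Num.Theory.
Local Open Scope ring_scope.
Local Open Scope complex_scope.

Variables (R : realType) (l : nat).
Hypotheses (l_pr : prime l) (l_odd : odd l).
Local Notation C := R[i].
Local Notation normc := (@Normc.normc R).

Section Char.
Variable chi : 'F_l -> C.
Hypotheses (chi0 : chi 0 = 0) (chi1 : chi 1 = 1).
Hypothesis chiM : forall x y, chi (x * y) = chi x * chi y.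

Lemma char_exp x n : chi (x ^+ n) = chi x ^+ n.
Proof. by elim: n => [|n IHn]; rewrite ?expr0// !exprS chiM IHn. Qed.

Lemma char_neq0 x : x != 0 -> chi x != 0.
Proof.
move=> x0; apply/eqP => cx0; have := chiM x x^-1.
by rewrite divff// chi1 cx0 mul0r => /eqP; rewrite oner_eq0.
Qed.

Lemma char_norm x : x != 0 -> normc (chi x) = 1.
Proof.
move=> x0; have l1 : (0 < l.-1)%N by rewrite -subn1 subn_gt0 prime_gt1.
apply/eqP; rewrite -(pexpr_eq1 l1) ?normc_ge0// -normcX -char_exp Fp_Fermat//.
by rewrite chi1 Normc.normc1.
Qed.

Lemma char_norm_le1 x : normc (chi x) <= 1.
Proof.
have [->|/char_norm ->//] := eqVneq x 0; by rewrite chi0 Normc.normc0.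
Qed.

(** Full periods sum to zero, and what is left has at most [l] terms of modulus at most 1. *)
Lemma char_partial_sum_le N : \sum_x chi x = 0 ->
  normc (\sum_(1 <= n < N.+1) chi n%:R) <= l%:R.
Proof.
move=> sum0; have -> : \sum_(1 <= n < N.+1) chi n%:R = \sum_(0 <= n < N.+1) chi n%:R.
  by rewrite [RHS]big_ltn// mulr0n chi0 add0r.
have per : \sum_(0 <= n < l) chi n%:R = 0.
  by rewrite -(big_Fp l_pr) -[RHS]sum0; apply: eq_bigr => x _; rewrite natr_Zp.
elim/ltn_ind: {N}N.+1 => N IHN; have [leNl|ltlN] := leqP N l.
  rewrite (le_trans (le_normc_sum _ _ _))//.
  rewrite (le_trans (ler_sum _ (fun n _ => char_norm_le1 _)))//.
  by rewrite sumr_const_nat subn0 ler_nat.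
have l_gt0 := prime_gt0 l_pr.
have := IHN (N - l)%N; rewrite ltn_subrL l_gt0 (leq_trans l_gt0 (ltnW ltlN)) => /(_ isT).
congr (normc _ <= _).
rewrite [RHS](@big_cat_nat _ _ _ l)//= ?(ltnW ltlN)// per add0r.
rewrite -[RHS]/(\sum_(0 + l <= i < N) chi i%:R) big_addn; apply: eq_bigr => n _.
by rewrite natrD pchar_Fp_0// addr0.
Qed.

End Char.

Section Odd.
Variable chi : 'F_l -> C.
Hypotheses (chi0 : chi 0 = 0) (chi1 : chi 1 = 1).
Hypothesis chiM : forall x y, chi (x * y) = chi x * chi y.
Hypothesis chiN1 : chi (-1) = -1.

(* [l] times the generalized Bernoulli number B_{1,chi} *)
Definition first_moment := \sum_x chi x * (val x)%:R.

Lemma charN x : chi (- x) = - chi x.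
Proof. by rewrite -mulN1r chiM chiN1 mulN1r. Qed.

Let two_neq0 : 2 != 0 :> C. Proof. by rewrite pnatr_eq0. Qed.

Lemma sum_odd_char : \sum_x chi x = 0.
Proof.
apply: (@sum_char_eq0 _ _ chi chiM (-1)); first by rewrite oppr_eq0 oner_eq0.
by rewrite chiN1 -subr_eq0 -opprD oppr_eq0 -(natrD _ 1 1).
Qed.

(* A real odd character exists only for l = 3 mod 4, and then the moment is an
   integer congruent to 0 + 1 + ... + (l - 1) modulo 2, hence odd. *)
Lemma first_moment_real : (forall x, x != 0 -> chi x ^+ 2 = 1) -> first_moment <> 0.
Proof.
move=> chi2 mom0; have [g g_prim gE] := Fp_generator l_pr.
have l1 : (0 < l.-1)%N by rewrite -subn1 subn_gt0 prime_gt1.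
have g0 : g != 0 by apply: contra_eq_neq (prim_expr_order g_prim) => ->;
  rewrite expr0n gtn_eqF// eq_sym oner_eq0.
have [i gi] : exists i, -1 = g ^+ i by apply: gE; rewrite oppr_eq0 oner_eq0.
(* An even [i] would make chi(-1) a power of some chi(g)^2 = 1. Since l - 1 divides 2i, its half
   then divides an odd number. *)
have i_odd : odd i.
  apply: contraT => i_even; have := chiN1.
  rewrite gi char_exp// -(odd_double_half i) (negPf i_even) add0n -mul2n exprM chi2// expr1n.
  by move=> /eqP; rewrite -subr_eq0 opprK -(natrD _ 1 1) pnatr_eq0.
have li : (l.-1 %| 2 * i)%N.
  by rewrite (prim_order_dvd g_prim) mulnC exprM -gi sqrrN expr1n.
have [h lh] : exists h, l.-1 = (2 * h)%N.
  by exists (l.-1)./2; rewrite mul2n even_halfK// -subn1 oddB ?prime_gt0// l_odd.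
have h_odd : odd h.
  by move: li; rewrite lh dvdn_pmul2l// => /dvdnP[k ik]; move: i_odd; rewrite ik oddM =>
    /andP[].
pose s (x : 'F_l) : nat := (chi x != 1).
have chis x : chi x * (val x)%:R = (val x)%:R - (2 * (s x * val x))%:R.
  have [->|x0] := eqVneq x 0; first by rewrite chi0 mul0r /= !muln0 subr0.
  rewrite /s; have /eqP := chi2 x x0; rewrite sqrf_eq1 => /orP[] /eqP ->.
    by rewrite eqxx mul0n muln0 subr0 mul1r.
  have /negPf -> /= : -1 != 1 :> C by rewrite -subr_eq0 -opprD oppr_eq0 -(natrD _ 1 1).
  by rewrite mul1n mul2n -addnn natrD; ring.
(* A zero moment would make 0 + 1 + ... + (l - 1) even, but this sum is [l * h] with both factors
   odd. *)
move: mom0; rewrite /first_moment (eq_bigr _ (fun x _ => chis x)) sumrB => /eqP.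
rewrite subr_eq0 -!natr_sum eqr_nat => /eqP; rewrite -big_distrr /=.
rewrite (big_Fp l_pr _ id) bin2_sum => /(congr1 odd); rewrite oddM /= bin2.
rewrite lh mulnCA mul2n doubleK oddM l_odd h_odd.
by [].
Qed.

Let psi x := (chi x)^-1.
Let psi0 : psi 0 = 0. Proof. by rewrite /psi chi0 invr0. Qed.
Let psi1 : psi 1 = 1. Proof. by rewrite /psi chi1 invr1. Qed.
Let psiM x y : psi (x * y) = psi x * psi y.
Proof. by rewrite /psi chiM invfM. Qed.

Let w : R := 2 * pi / l%:R.
Let z : C := cos w +i* sin w.

Let zX n : z ^+ n = cos (n%:R * w) +i* sin (n%:R * w).
Proof.
elim: n => [|n IHn]; first by rewrite mul0r cos0 sin0.
rewrite exprSr IHn -natr1 mulrDl mul1r cosD sinD.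
by apply/eqP; rewrite eq_complex /= eqxx; apply/eqP; ring.
Qed.

Let l_gt0 : 0 < l%:R :> R. Proof. by rewrite ltr0n prime_gt0. Qed.

Let zl : z ^+ l = 1.
Proof.
rewrite zX (_ : l%:R * w = pi *+ 2); last by rewrite /w -mulr_natl; field; rewrite gt_eqF.
by rewrite cos2pi sin2pi.
Qed.

Let z_neq1 : z != 1.
Proof.
rewrite eq_complex /= negb_and; apply/orP; right; rewrite gt_eqF// sin_gt0_pi//.
have pi0 := pi_gt0 R; have l3 : 3 <= l%:R :> R by rewrite ler_nat odd_prime_gt2.
rewrite /w divr_gt0 ?mulr_gt0//= ltr_pdivrMr//; nra.
Qed.

Let z_prim : l.-primitive_root z.
Proof.
have [m m_prim] := prim_order_exists (prime_gt0 l_pr) zl.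
move/(prime_nt_dvdP l_pr) => ml; rewrite -ml//.
apply/eqP => m1; move: (prim_expr_order m_prim); rewrite m1 expr1.
by move/eqP; rewrite (negPf z_neq1).
Qed.

(** The additive character of F_l; the sums [G] below are the Gauss sums of [chi]. *)
Let e (x : 'F_l) : C := z ^+ val x.

Let e_nat n : e n%:R = z ^+ n.
Proof. by rewrite /e (val_Fp_nat l_pr n : val (n%:R : 'F_l) = _) expr_mod. Qed.

Let e_natM n a : e (n%:R * a) = z ^+ (n * val a).
Proof. by rewrite -[a in LHS]natr_Zp -natrM e_nat. Qed.

Let eN x : e (- x) = (e x)^*.
Proof.
have e1 : e x * e (- x) = 1.
  rewrite -[x]natr_Zp -[- _]natr_Zp !e_nat -exprD -e_nat natrD !natr_Zp subrr.
  by rewrite /e expr0.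
have e2 : e x * (e x)^* = 1.
  rewrite /e zX; apply/eqP; rewrite eq_complex /= mulrN opprK -!expr2 cos2Dsin2 eqxx.
  by apply/eqP; ring.
have e0 : e x != 0 by apply: contra_eq_neq e1 => ->; rewrite mul0r eq_sym oner_eq0.
by apply: (mulfI e0); rewrite e1 e2.
Qed.

Let G x := \sum_a chi a * e (x * a).

Let G_psi x : G x = psi x * G 1.
Proof.
have [->|x0] := eqVneq x 0.
  rewrite psi0 mul0r /G -[RHS]sum_odd_char; apply: eq_bigr => a _.
  by rewrite mul0r /e expr0 mulr1.
rewrite /G (reindex_inj (mulfI (invr_neq0 x0))) mulr_sumr; apply: eq_bigr => a _.
rewrite mulrA divff// mul1r chiM mulrA /psi; congr (_ * _ * _).
by apply: (mulfI (char_neq0 chi1 chiM x0)); rewrite -chiM !divff ?char_neq0.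
Qed.

Let GN x : G (- x) = - G x.
Proof.
rewrite /G (reindex_inj oppr_inj) -sumrN; apply: eq_bigr => a _.
by rewrite mulrNN charN mulNr.
Qed.

(** Otherwise every [G n%:R] vanishes, and the polynomial with coefficients chi(i), of size at most
    [l], has [l] distinct roots z^n. *)
Let G1_neq0 : G 1 != 0.
Proof.
apply/eqP => G10; pose q : {poly C} := \poly_(i < l) chi i%:R.
have q0 : q = 0.
  apply/eqP; apply: contraT => q_neq0.
  have roots : all (root q) [seq z ^+ i | i <- iota 0 l].
    apply/allP => _ /mapP[n _ ->]; apply/rootP; rewrite horner_poly.
    transitivity (G n%:R); last by rewrite G_psi G10 mulr0.
    rewrite -(big_mkord xpredT (fun i => chi i%:R * (z ^+ n) ^+ i)) -(big_Fp l_pr).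
    by apply: eq_bigr => a _; rewrite e_natM natr_Zp exprM.
  have uroots : uniq [seq z ^+ i | i <- iota 0 l].
    rewrite map_inj_in_uniq ?iota_uniq// => i j; rewrite !mem_iota add0n /= => il jl.
    by move/eqP; rewrite (eq_prim_root_expr z_prim) !modn_small// => /eqP.
  have := max_poly_roots q_neq0 roots uroots.
  by rewrite size_map size_iota ltnNge size_poly.
have := coef_poly l (fun i => chi i%:R) 1; rewrite -/q q0 coef0 prime_gt1// chi1.
by move/esym/eqP; rewrite oner_eq0.
Qed.

Let theta (a : 'F_l) : R := (val a)%:R * w.

Let G_sin n : G n%:R = 'i%C * \sum_a chi a * (sin (n%:R * theta a))%:C.
Proof.
apply: (mulfI two_neq0); rewrite mulr_natl mulr2n -{2}[G n%:R]opprK -GN.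
rewrite /G -sumrN -big_split /= !mulr_sumr; apply: eq_bigr => a _.
rewrite mulNr eN e_natM zX /theta natrM -[n%:R * _ * w]mulrA.
case: (chi a) => u v; apply/eqP; rewrite eq_complex /=.
by apply/andP; split; apply/eqP; ring.
Qed.

(** Multiplied by G(1), the sum becomes i times the sum of chi(a) [sin_sum N (theta a)]. The limits
    (pi - theta a)/2 contribute only multiples of the sum of chi and of the first moment, both zero,
    so just the sawtooth errors remain. *)
Lemma sum_conj_char_le : first_moment = 0 -> exists c : R, forall N, (0 < N)%N ->
  normc (\sum_(1 <= n < N.+1) psi n%:R * n%:R^-1%:C) <= c / N%:R.
Proof.
move=> mom0; have pi0 := pi_gt0 R.
have [c hc] : exists c : 'F_l -> R, forall a, a != 0 -> forall N, (0 < N)%N ->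
    `|sin_sum N (theta a) - 2^-1 * (pi - theta a)| <= c a / N%:R.
  apply: (@fin_all_exists 'F_l (fun=> R) (fun a (c : R) => a != 0 -> forall N, (0 < N)%N ->
    `|sin_sum N (theta a) - 2^-1 * (pi - theta a)| <= c / N%:R)) => a.
  have [->|a0] := eqVneq a 0; first by exists 0.
  have [|c hc] := @sawtooth R (theta a); last by exists c.
  have va : (0 < val a)%N by rewrite lt0n; apply: contraNneq a0 => va; apply/eqP/val_inj.
  have vl : (val a < l)%N by rewrite -[X in (_ < X)%N](Fp_cast l_pr) ltn_ord.
  have w0 : 0 < w by rewrite divr_gt0 ?mulr_gt0.
  rewrite /theta mulr_gt0 ?ltr0n//= (_ : 2 * pi = l%:R * w); last by rewrite /w; field;
    rewrite gt_eqF.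
  by rewrite /theta ltr_pM2r// ltr_nat.
exists ((\sum_(a | a != 0) c a) / normc (G 1)) => N N0.
have nG0 : 0 < normc (G 1).
  by rewrite lt_neqAle normc_ge0 andbT eq_sym; apply: contra_neq G1_neq0 => /Normc.eq0_normc.
rewrite mulrAC ler_pdivlMr// -Normc.normcM.
have -> : (\sum_(1 <= n < N.+1) psi n%:R * n%:R^-1%:C) * G 1 =
   'i%C * \sum_a chi a * (sin_sum N (theta a))%:C.
  rewrite mulr_suml (eq_bigr (fun n : nat => 'i%C * (\sum_a chi a * (sin (n%:R * theta a) *
    n%:R^-1)%:C))).
    rewrite -mulr_sumr exchange_big/=; congr (_ * _); apply: eq_bigr => a _.
    by rewrite -mulr_sumr /sin_sum (rmorph_sum (real_complex R)).
  move=> n _; rewrite mulrAC -G_psi G_sin -mulrA mulr_suml; congr (_ * _).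
  by apply: eq_bigr => a _; rewrite (rmorphM (real_complex R))/= -mulrA.
have lin0 : \sum_a chi a * (2^-1 * (pi - theta a))%:C = 0.
  transitivity ((2^-1 * pi)%:C * \sum_a chi a - (2^-1 * w)%:C * first_moment).
    rewrite !mulr_sumr -sumrB; apply: eq_bigr => a _; rewrite /theta.
    rewrite -(rmorph_nat (real_complex R)) (_ : 2^-1 * _ = 2^-1 * pi - 2^-1 * w * (val
      a)%:R); last by ring.
    by rewrite (rmorphB (real_complex R)) (rmorphM (real_complex R) (2^-1 * w))/=; ring.
  by rewrite sum_odd_char mom0 !mulr0 subrr.
have -> : \sum_a chi a * (sin_sum N (theta a))%:C =
    \sum_a chi a * (sin_sum N (theta a) - 2^-1 * (pi - theta a))%:C.
  under [RHS]eq_bigr do rewrite (rmorphB (real_complex R))/= mulrBr.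
  by rewrite sumrB lin0 subr0.
rewrite Normc.normcM.
have -> : normc 'i%C = 1 by rewrite /= expr0n expr1n add0r sqrtr1.
rewrite mul1r (le_trans (le_normc_sum _ _ _))// (bigID (fun a => a != 0))/=.
rewrite [X in _ + X]big1 => [|a /negPn/eqP ->]; last by rewrite chi0 mul0r Normc.normc0.
rewrite addr0 mulr_suml; apply: ler_sum => a a0.
rewrite Normc.normcM char_norm// mul1r normc_real.
exact: hc.
Qed.

(** For chi not real, chi^2 is nontrivial, which gives the bounded partial sums of psi^2 that the
    3-4-1 argument requires. *)
Theorem first_moment_neq0 : first_moment <> 0.
Proof.
have [/forallP real|] := boolP [forall x, (x != 0) ==> (chi x ^+ 2 == 1)].
  by apply: first_moment_real => x x0; apply/eqP; have := real x; rewrite x0.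
rewrite negb_forall => /existsP[y]; rewrite negb_imply => /andP[y0 chiy].
move=> /sum_conj_char_le[c hc].
apply: (@L_one_neq0 R (fun n => psi n%:R) l%:R c) => //.
- by move=> m n; rewrite natrM psiM.
- move=> n; have [->|n0] := eqVneq (n%:R : 'F_l) 0; first by left.
  by right; apply: char_norm.
- move=> N; have psi2M x x' : psi (x * x') ^+ 2 = psi x ^+ 2 * psi x' ^+ 2.
    by rewrite psiM exprMn.
  apply: (@char_partial_sum_le (fun x => psi x ^+ 2)) => //.
  + by rewrite psi0 expr0n.
  + by rewrite psi1 expr1n.
  + apply: (@sum_char_eq0 _ _ (fun x => psi x ^+ 2) _ y) => //.
    by rewrite /psi exprVn invr_eq1.
Qed.

End Odd.
End OddCharacter.

(** * Singular Demjanenko matrices *)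

Section Fourier.
Import Order.TTheory GRing.Theory Num.Theory.
Local Open Scope ring_scope.

Lemma closed_prim_root (C : numClosedFieldType) n :
  (0 < n)%N -> exists z : C, n.-primitive_root z.
Proof.
move=> n_gt0; pose p : {poly C} := 'X^n - 1.
have [r Dp] := closed_field_poly_normal p.
rewrite (monicP _) ?monicXnsubC // scale1r in Dp.
have rn1 : all n.-unity_root r by apply/allP=> z; rewrite -root_prod_XsubC -Dp.
have sz_r : (n < (size r).+1)%N by rewrite -(size_prod_XsubC r id) -Dp size_XnsubC.
have [|z] := hasP (has_prim_root n_gt0 rn1 _ sz_r); last by exists z.
by rewrite -separable_prod_XsubC -Dp separable_Xn_sub_1 // pnatr_eq0 -lt0n.
Qed.

Variables (C : numClosedFieldType) (l : nat) (l_pr : prime l).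
Local Notation U := {unit 'F_l}.

Lemma uval_neq0 (x : U) : FinRing.uval x != 0.
Proof. by rewrite -unitfE; exact: (valP x). Qed.

Lemma uval_inj : injective (@FinRing.uval 'F_l : U -> 'F_l).
Proof. exact: val_inj. Qed.

Lemma sum_units (V : zmodType) (F : 'F_l -> V) : F 0 = 0 ->
  \sum_x F x = \sum_(u : U) F (FinRing.uval u).
Proof.
move=> F0; rewrite (bigID (fun x => x \is a GRing.unit)) /= [X in _ + X]big1 ?addr0;
  last first.
  by move=> x; rewrite unitfE negbK => /eqP ->.
rewrite (reindex_onto (fun u : U => FinRing.uval u) (insubd (1%g : U))) => [|x ux].
  by apply: eq_bigl => u; rewrite (valP u) valKd eqxx.
by rewrite val_insubd ux.
Qed.

(* The sums for the various characters are the values at the (l-1)-th roots of unity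
   of a nonzero polynomial of size at most l-1. *)
Lemma exists_char_sum_neq0 (v : U -> C) : (exists u, v u != 0) ->
  exists chi : 'F_l -> C, [/\ chi 0 = 0, chi 1 = 1,
    forall x y, chi (x * y) = chi x * chi y &
    \sum_u v u * chi (FinRing.uval u) != 0].
Proof.
move=> [u0 vu0]; have [g g_prim gE] := Fp_generator l_pr.
have l1 : (0 < l.-1)%N by rewrite -subn1 subn_gt0 prime_gt1.
have [z z_prim] := closed_prim_root C l1.
pose dlog x := find (fun i => g ^+ i == x) (iota 0 l.-1).
have hasd x : x != 0 -> has (fun i => g ^+ i == x) (iota 0 l.-1).
  move=> x0; have [i ->] := gE x x0; apply/hasP; exists (i %% l.-1)%N.
    by rewrite mem_iota add0n /= ltn_mod.
  by rewrite (prim_expr_mod g_prim).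
have dlogK x : x != 0 -> g ^+ dlog x = x.
  move=> x0; have := nth_find 0%N (hasd x x0); rewrite nth_iota ?add0n => [/eqP //|].
  by have := hasd x x0; rewrite has_find size_iota.
have dlog_lt x : x != 0 -> (dlog x < l.-1)%N.
  by move=> x0; have := hasd x x0; rewrite has_find size_iota.
(* The character sending g to z^j, extended by 0. *)
pose chi j x := if x == 0 then 0 else z ^+ (j * dlog x).
have chi1 j : chi j 1 = 1.
  rewrite /chi oner_eq0 (_ : dlog 1 = 0%N) ?muln0//.
  by rewrite /dlog -(prednK l1) /= ?expr0 ?eqxx.
have chiM j x y : chi j (x * y) = chi j x * chi j y.
  rewrite /chi mulf_eq0; have [|x0] := eqVneq x 0; first by rewrite mul0r.
  have [|y0] /= := eqVneq y 0; first by rewrite mulr0.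
  rewrite -exprD -mulnDr ![(j * _)%N]mulnC !exprM; congr (_ ^+ j); apply/eqP.
  rewrite (eq_prim_root_expr z_prim) -(eq_prim_root_expr g_prim).
  by rewrite exprD !dlogK// mulf_neq0.
have [/existsP[j Vj]|] := boolP [exists j : 'I_l.-1, \sum_u v u * chi j (FinRing.uval u) != 0].
  by exists (chi j); split=> //; rewrite /chi eqxx.
rewrite negb_exists => /forallP no_chi.
pose q : {poly C} := \sum_u (v u)%:P * 'X^(dlog (FinRing.uval u)).
have q_root j : (j < l.-1)%N -> root q (z ^+ j).
  move=> jl; have := no_chi (Ordinal jl); rewrite negbK => /eqP sum0.
  apply/rootP; rewrite /q horner_sum -[RHS]sum0; apply: eq_bigr => u _.
  by rewrite hornerM hornerC hornerXn /chi (negPf (uval_neq0 u)) -exprM.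
have q0 : q = 0.
  apply/eqP; apply: contraT => q_neq0.
  have roots : all (root q) [seq z ^+ i | i <- iota 0 l.-1].
    by apply/allP => _ /mapP[n ni ->]; apply: q_root; move: ni; rewrite mem_iota.
  have uroots : uniq [seq z ^+ i | i <- iota 0 l.-1].
    rewrite map_inj_in_uniq ?iota_uniq// => i j; rewrite !mem_iota add0n /= => il jl.
    by move/eqP; rewrite (eq_prim_root_expr z_prim) !modn_small// => /eqP.
  have := max_poly_roots q_neq0 roots uroots.
  rewrite size_map size_iota ltnNge (leq_trans (size_sum _ _ _))//.
  apply/bigmax_leqP => u _; rewrite (leq_trans (size_polyMleq _ _))// size_polyXn addnS /=.
  by rewrite (leq_trans (leq_add (size_polyC_leq1 _) (leqnn _)))// add1n dlog_lt// uval_neq0.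
have := coef0 C (dlog (FinRing.uval u0)); rewrite -{1}q0 coef_sum (bigD1 u0)//=.
rewrite coefCM coefXn eqxx mulr1 big1 ?addr0; first by move/eqP; rewrite (negPf vu0).
move=> u neq; rewrite coefCM coefXn; case: eqP => [e|]; last by rewrite mulr0.
case/eqP: neq; apply: uval_inj.
by rewrite -[LHS]dlogK ?uval_neq0// -e dlogK ?uval_neq0.
Qed.

End Fourier.

Section FpValues.
Import Order.TTheory GRing.Theory Num.Theory.
Local Open Scope ring_scope.
Variables (l : nat) (l_pr : prime l).

Lemma val_Fp_lt (x : 'F_l) : (val x < l)%N.
Proof. by rewrite -[X in (_ < X)%N](Fp_cast l_pr) ltn_ord. Qed.

Lemma val_FpD (x y : 'F_l) : val (x + y) = ((val x + val y) %% l)%N.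
Proof. by congr (_ %% _)%N; exact: Fp_cast. Qed.

Lemma val_Fp_gt0 (x : 'F_l) : x != 0 -> (0 < val x)%N.
Proof. by move=> x0; rewrite lt0n; apply: contraNneq x0 => va; apply/eqP/val_inj. Qed.

Lemma val_FpN (x : 'F_l) : x != 0 -> val (- x) = (l - val x)%N.
Proof.
move=> x0; have xN0 : - x != 0 by rewrite oppr_eq0.
have := val_FpD x (- x); rewrite subrr => /esym/eqP; rewrite -/(dvdn _ _) => /dvdnP[q].
have := val_Fp_lt x; have := val_Fp_lt (- x).
have := val_Fp_gt0 x0; have := val_Fp_gt0 xN0; case: q => [|[|q]]; nia.
Qed.

Lemma natr_Fp_neq0 n : (0 < n < l)%N -> (n%:R : 'F_l) != 0.
Proof.
move=> /andP[n0 nl]; rewrite -(dvdn_pcharf (pchar_Fp l_pr)).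
by apply/negP => /dvdn_leq - /(_ n0); rewrite leqNgt nl.
Qed.

End FpValues.

(** * From a kernel vector to an odd character *)

Section Demjanenko.
Import Order.TTheory GRing.Theory Num.Theory.
Local Open Scope ring_scope.

Variables (l k : nat) (l_pr : prime l).
Local Notation U := {unit 'F_l}.
Local Notation uval := FinRing.uval.
Local Notation M := (demj_set k l).
Local Notation W := (demj_stab k l).

Lemma in_demj_set (a : U) :
  (a \in M) = (val (k%:R * uval a)%R + val (uval a) < l)%N.
Proof. by rewrite inE. Qed.

(** [demj_E k a] is the carry in the addition of the residues of ka and a modulo [l]. *)
Lemma demj_E_mul (a : U) :
  (val (k%:R * uval a)%R + val (uval a) =
   val ((k%:R + 1) * uval a)%R + l * demj_E k a)%N.
Proof.
rewrite mulrDl mul1r (val_FpD l_pr) /demj_E.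
rewrite in_demj_set.
have := val_Fp_lt l_pr (uval a); have := val_Fp_lt l_pr (k%:R * uval a).
set x := val (k%:R * uval a); set y := val (uval a) => xl yl.
case: ltnP => [lt|le]; first by rewrite modn_small// muln0 addn0.
by rewrite -[in RHS](subnK le) modnDr modn_small ?muln1 ?subnK//; lia.
Qed.

Lemma group_set_demj_stab : group_set W.
Proof.
apply/group_setP; split.
  by rewrite inE; apply/eqP/setP => x; rewrite mem_lcoset invg1 mul1g.
by move=> x y; rewrite !inE => /eqP Mx /eqP My; rewrite lcosetM My Mx.
Qed.

Canonical demj_stab_group := group group_set_demj_stab.

Lemma demj_E_stab (w a : U) : w \in W -> demj_E k (w * a)%g = demj_E k a.
Proof. by move=> Ww; rewrite /demj_E demj_stabM. Qed.

Lemma unitC (u v : U) : (u * v = v * u)%g.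
Proof. by apply: val_inj; exact: mulrC. Qed.

Lemma unit_oppM (u v : U) : (u * unit_opp v = unit_opp (u * v))%g.
Proof. by apply: val_inj; exact: mulrN. Qed.

Lemma unit_oppK (u : U) : unit_opp (unit_opp u) = u.
Proof. by apply: val_inj; exact: opprK. Qed.

Lemma unit_opp_inj : injective (@unit_opp l).
Proof. exact: can_inj unit_oppK. Qed.

Local Notation orbit i := (enum_val (i : 'I_(#|demj_orbits k l|))).

Lemma mem_repr_orbit i : repr (orbit i) \in orbit i.
Proof.
have /rcosetsP[x _ ->] := enum_valP i.
by rewrite mem_repr_rcoset.
Qed.

Lemma orbitE i : orbit i = (W :* repr (orbit i))%g.
Proof.
have /rcosetsP[x _ e] := enum_valP i.
by rewrite e rcoset_repr.
Qed.

Lemma repr_orbit_in i : repr (orbit i) \in M.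
Proof.
have /rcosetsP[x Mx e] := enum_valP i.
have := mem_repr_orbit i; rewrite {2}e => /rcosetP[w Ww ->].
by rewrite demj_stabM.
Qed.

Lemma orbit_sub i x : x \in orbit i -> x \in M.
Proof.
rewrite orbitE => /rcosetP[w Ww ->]; by rewrite demj_stabM// repr_orbit_in.
Qed.

Lemma orbit_inj i j : repr (orbit j) \in orbit i -> i = j.
Proof.
rewrite {1}[orbit i]orbitE => /(@rcoset_eqP _ demj_stab_group) e.
by apply: enum_val_inj; rewrite orbitE [RHS]orbitE.
Qed.

Lemma mem_some_orbit a :
  a \in M -> exists j w, w \in W /\ a = (w * repr (orbit j))%g.
Proof.
move=> Ma; have O : (W :* a)%g \in demj_orbits k l by apply/rcosetsP; exists a.
exists (enum_rank_in O (W :* a)%g).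
have : a \in orbit (enum_rank_in O (W :* a)%g) by rewrite enum_rankK_in// rcoset_refl.
by rewrite {1}[orbit _]orbitE => /rcosetP[w Ww e]; exists w.
Qed.

Hypotheses (k_gt0 : (0 < k)%N) (k_le : (k <= l - 2)%N).

Let l_gt2 : (2 < l)%N. Proof. lia. Qed.

Let k0 : (k%:R : 'F_l) != 0. Proof. by apply: natr_Fp_neq0; lia. Qed.

Let k1 : (k%:R + 1 : 'F_l) != 0.
Proof. by rewrite natr1; apply: natr_Fp_neq0; lia. Qed.

(** Negation turns a residue x into l - x, which reverses the inequality; equality with [l] is
    excluded because (k + 1)a is nonzero. *)
Lemma demj_setN (a : U) : (unit_opp a \in M) = (a \notin M).
Proof.
have a0 := uval_neq0 a; have ka0 := mulf_neq0 k0 a0.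
have s0 : k%:R * uval a + uval a != 0 by rewrite -[X in _ + X]mul1r -mulrDl mulf_neq0.
rewrite !in_demj_set mulrN !val_FpN//.
have aux x y : (x < l)%N -> (y < l)%N -> (x + y != l)%N ->
  (l - x + (l - y) < l)%N = ~~ (x + y < l)%N by lia.
apply: aux; [exact: (val_Fp_lt l_pr) | exact: (val_Fp_lt l_pr) |].
have : (val (k%:R * uval a)%R + val (uval a) != l)%N.
  apply: contraNneq s0 => e; apply/eqP/val_inj.
  exact: etrans (val_FpD l_pr _ _) (etrans (congr1 (modn^~ l) e) (modnn l)).
by [].
Qed.

Lemma demj_EN (a : U) : demj_E k (unit_opp a) = (1 - demj_E k a)%N.
Proof. by rewrite /demj_E demj_setN; case: (a \in M). Qed.

Lemma singular_odd_character (C : numClosedFieldType) :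
  \det (demj_matrix k l) = 0 ->
  exists chi : 'F_l -> C, [/\ chi 0 = 0, chi 1 = 1,
    forall x y, chi (x * y) = chi x * chi y, chi (-1) = -1 &
    (forall w, w \in W -> chi (uval w) = 1) /\
    \sum_(a : U) chi (uval a) * (demj_E k a)%:R = 0].
Proof.
move=> /eqP/det0P[u' u'0 /rowP uD].
pose u i : C := ratr (u' 0 i).
pose F (a : U) : C := (demj_E k a)%:R - 1 / 2.
have FN a : F (unit_opp a) = - F a.
  rewrite /F demj_EN natrB; last by rewrite /demj_E; case: ifP.
  by field.
have FW w a : w \in W -> F (w * a)%g = F a by move=> Ww; rewrite /F demj_E_stab.
(* The entry E(-c^-1 a) - 1/2 is -F(c^-1 a) because F is odd. *)
have sumF0 j : \sum_i u i * F ((repr (orbit i))^-1 * repr (orbit j))%g = 0.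
  have := congr1 (ratr : rat -> C) (uD j); rewrite !mxE rmorph_sum rmorph0 /= => h.
  apply: oppr_inj; rewrite oppr0 -[RHS]h -sumrN; apply: eq_bigr => i _.
  rewrite mxE rmorphM/= /demj_entry -mulrN -FN /F; congr (_ * _).
  by rewrite rmorphB fmorph_div !rmorph_nat rmorph1.
(* From representatives to all of M by W-invariance, then to the complement of M by oddness. *)
have sumF a : \sum_i u i * F ((repr (orbit i))^-1 * a)%g = 0.
  wlog Ma : a / a \in M => [th|].
    have [/th //|] := boolP (a \in M); rewrite -demj_setN => /th h.
    apply: oppr_inj; rewrite oppr0 -[RHS]h -sumrN; apply: eq_bigr => i _.
    by rewrite unit_oppM FN mulrN.
  have [j [w [Ww ->]]] := mem_some_orbit Ma; rewrite -[RHS](sumF0 j).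
  by apply: eq_bigr => i _; rewrite mulgA (unitC _ w) -mulgA FW.
(* The odd W-invariant function that extends the kernel vector. *)
pose v (x : U) : C := \sum_i u i * ((x \in orbit i)%:R - (unit_opp x \in orbit i)%:R).
have v_neq0 : exists x, v x != 0.
  have [j uj] : exists j, u' 0 j != 0.
    apply/existsP; apply: contraNT u'0; rewrite negb_exists => /forallP h.
    by apply/eqP/rowP => j; rewrite mxE; apply/eqP; rewrite -[_ == _]negbK h.
  exists (repr (orbit j)); rewrite /v (bigD1 j)//= mem_repr_orbit big1 => [|i ij].
    rewrite addr0 (negPf (_ : unit_opp _ \notin _)) ?subr0 ?mulr1 ?fmorph_eq0//.
    by apply: contraL (repr_orbit_in j) => /orbit_sub; rewrite demj_setN.
  rewrite (negPf (_ : repr _ \notin orbit i)); last by apply: contraNN ij => /orbit_inj ->.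
  rewrite (negPf (_ : unit_opp _ \notin _)) ?subrr ?mulr0//.
  by apply: contraL (repr_orbit_in j) => /orbit_sub; rewrite demj_setN.
have [chi [chi0 chi1 chiM V_neq0]] := exists_char_sum_neq0 l_pr v_neq0.
pose X := \sum_i u i * chi (uval (repr (orbit i))).
pose S := \sum_(w in W) chi (uval w).
have sum_orbit i : \sum_(x in orbit i) chi (uval x) = S * chi (uval (repr (orbit i))).
  rewrite {1}orbitE; set r := repr _.
  rewrite -rcosetE big_imset /= => [|x y _ _ /mulIg //].
  by rewrite mulr_suml; apply: eq_bigr => w _; rewrite chiM.
have V_E : \sum_x v x * chi (uval x) = (1 - chi (-1)) * S * X.
  rewrite -mulrA mulr_sumr mulr_sumr; under eq_bigr do rewrite mulr_suml.
  rewrite exchange_big; apply: eq_bigr => i _ /=.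
  rewrite (eq_bigr (fun x => u i * ((x \in orbit i)%:R * chi (uval x) -
     (unit_opp x \in orbit i)%:R * chi (uval x)))) => [|x _]; last by ring.
  rewrite -mulr_sumr sumrB.
  have -> : \sum_x (x \in orbit i)%:R * chi (uval x) = S * chi (uval (repr (orbit i))).
    rewrite -sum_orbit [RHS]big_mkcond; apply: eq_bigr => x _.
    by case: ifP => _; rewrite ?mul1r ?mul0r.
  have -> : \sum_x (unit_opp x \in orbit i)%:R * chi (uval x)
      = chi (-1) * (S * chi (uval (repr (orbit i)))).
    rewrite -sum_orbit [X in _ * X]big_mkcond (reindex_inj unit_opp_inj) mulr_sumr.
    apply: eq_bigr => x _; rewrite unit_oppK.
    have -> : chi (uval (unit_opp x)) = chi (-1) * chi (uval x) by rewrite -chiM mulN1r.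
    by case: ifP => _; rewrite ?mul1r ?mul0r ?mulr0.
  ring.
(* Each factor has its use: the first makes chi odd, [S] forces chi to be trivial on W, and [X] can
   be cancelled in the transform of [sumF]. *)
move: V_neq0; rewrite V_E !mulf_eq0 !negb_or => /andP[/andP[chiN1 S_neq0] X_neq0].
have chiN : chi (-1) = -1.
  have /eqP : chi (-1) ^+ 2 = 1 by rewrite expr2 -chiM mulrNN mulr1.
  rewrite sqrf_eq1 => /orP[/eqP e|/eqP //].
  by rewrite e subrr eqxx in chiN1.
exists chi; split=> //; split=> [w Ww|].
  have /eqP : chi (uval w) * S = S.
    rewrite mulr_sumr [RHS](reindex_inj (mulgI w)) /=.
    apply: eq_big => [w'|w' _]; first by rewrite (groupMl _ (Ww : w \in demj_stab_group)).
    by rewrite -chiM.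
  by rewrite -subr_eq0 -{2}[S]mul1r -mulrBl mulf_eq0 (negPf S_neq0) orbF subr_eq0 => /eqP.
have sum_chi0 : \sum_(a : U) chi (uval a) = 0.
  rewrite -sum_units//; apply: (@sum_char_eq0 _ _ chi chiM (-1)).
    by rewrite oppr_eq0 oner_eq0.
  by move: chiN1; rewrite subr_eq0 eq_sym.
have Fhat : \sum_(b : U) chi (uval b) * F b = 0.
  apply: (mulfI X_neq0); rewrite mulr0.
  transitivity (\sum_(a : U) chi (uval a) * \sum_i u i * F ((repr (orbit i))^-1 * a)%g);
    last by rewrite big1// => a _; rewrite sumF mulr0.
  under [RHS]eq_bigr do rewrite mulr_sumr.
  rewrite exchange_big mulr_suml; apply: eq_bigr => i _ /=.
  rewrite mulr_sumr [RHS](reindex_inj (mulgI (repr (orbit i)))) /=.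
  by apply: eq_bigr => b _; rewrite mulKg chiM; ring.
rewrite -[RHS]Fhat; under [RHS]eq_bigr do rewrite /F mulrBr.
by rewrite sumrB -mulr_suml sum_chi0 mul0r subr0.
Qed.

End Demjanenko.

(** * The relation between roots of unity and its trace in F_l *)

Section Roots.
Import Order.TTheory GRing.Theory Num.Theory.
Local Open Scope ring_scope.

Variables (R : realType) (l k : nat) (l_pr : prime l).
Local Notation U := {unit 'F_l}.
Local Notation uval := FinRing.uval.
Local Notation C := (R[i])%C.

(** Put a = <kj> and b = <j>. As k^2 j = -(kj + j), the sum tested for kj is l - b if a + b < l and
    2l - b otherwise, so membership is unchanged. *)
Lemma cube_root_in_stab (w : U) : uval w = k%:R ->
  k%:R ^+ 2 + k%:R + 1 = 0 :> 'F_l -> w \in demj_stab k l.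
Proof.
move=> wk kk; have k0 : (k%:R : 'F_l) != 0 by rewrite -wk uval_neq0.
have memM (j : U) : (w * j)%g \in demj_set k l = (j \in demj_set k l).
  rewrite !in_demj_set // -[uval (w * j)%g]/(uval w * uval j) wk.
  have j0 := uval_neq0 j; have kj0 := mulf_neq0 k0 j0.
  have e : k%:R * (k%:R * uval j) = - (k%:R * uval j + uval j).
    by apply/eqP; rewrite -addr_eq0 -[X in _ == X](mul0r (uval j)) -kk; apply/eqP; ring.
  have s0 : k%:R * uval j + uval j != 0.
    by rewrite -oppr_eq0 -e !mulf_neq0.
  rewrite e val_FpN// val_FpD//.
  have := val_Fp_gt0 s0; rewrite val_FpD//.
  move: (val_Fp_lt l_pr (uval j)) (val_Fp_lt l_pr (k%:R * uval j)) (val_Fp_gt0 j0)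
    (val_Fp_gt0 kj0).
  move: (val (uval j)) (val (k%:R * uval j)) => a b al bl a0 b0.
  have [lt|le] := ltnP (b + a) l; first by rewrite modn_small//; lia.
  by rewrite -(subnK le) modnDr modn_small; lia.
rewrite inE; apply/eqP/setP => j; rewrite mem_lcoset -memM.
by rewrite mulKVg.
Qed.

(* An element y <> 1 of 2-power order has -1 among its powers. *)
Lemma eq1_of_2pow_char (psi : 'F_l -> C) a (y : 'F_l) :
  (forall x x', psi (x * x') = psi x * psi x') -> psi (-1) <> 1 ->
  y ^+ (2 ^ a) = 1 -> psi y = 1 -> y = 1.
Proof.
move=> psiM psiN1; elim: a y => [|a IHa] y; first by rewrite expn0 expr1.
rewrite expnS exprM => /IHa {}IHa psiy.
have /eqP : y ^+ 2 = 1 by apply: IHa; rewrite expr2 psiM psiy mulr1.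
by rewrite sqrf_eq1 => /orP[/eqP //|/eqP yN1]; case: psiN1; rewrite -yN1.
Qed.

Hypotheses (k_gt0 : (0 < k)%N) (k_le : (k <= l - 2)%N).

Lemma singular_roots alpha n : odd n -> l = (2 ^ alpha * n + 1)%N ->
  \det (demj_matrix k l) = 0 ->
  [/\ (3 %| n)%N, (k%:R : 'F_l) ^+ n = 1, (k%:R + 1 : 'F_l) ^+ n = -1 &
     (k%:R : 'F_l) ^+ 2 + k%:R + 1 != 0].
Proof.
move=> n_odd lE det0.
have l_odd : odd l by case: (even_prime l_pr) => // l2; move: k_gt0 k_le; rewrite l2; lia.
have [chi [chi0 chi1 chiM chiN1 [chiW sumE]]] := singular_odd_character l_pr k_gt0 k_le C det0.
have mom0 := first_moment_neq0 l_pr l_odd chi0 chi1 chiM chiN1.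
set x : 'F_l := k%:R.
have x0 : x != 0 by apply: natr_Fp_neq0 => //; lia.
have x1 : x + 1 != 0 by rewrite /x natr1; apply: natr_Fp_neq0 => //; lia.
pose psi y := (chi y)^-1.
have psiM y y' : psi (y * y') = psi y * psi y' by rewrite /psi chiM invfM.
have psi1 : psi 1 = 1 by rewrite /psi chi1 invr1.
have psiX y m : psi (y ^+ m) = psi y ^+ m.
  by elim: m => [|m IHm]; rewrite ?expr0// !exprS psiM IHm.
have psiN1 : psi (-1) = -1 by rewrite /psi chiN1 invrN invr1.
have shift c : c != 0 -> \sum_y chi y * (val (c * y))%:R = psi c * first_moment chi.
  move=> c0; rewrite /first_moment mulr_sumr (reindex_inj (mulfI (invr_neq0 c0))).
  apply: eq_bigr => y _; rewrite mulVKf// chiM mulrA; congr (_ * _ * _).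
  have cc : chi c * chi c^-1 = 1 by rewrite -chiM divff.
  have cc0 : chi c != 0 by apply: contra_eq_neq cc => ->; rewrite mul0r eq_sym oner_eq0.
  by apply: (mulfI cc0); rewrite cc divff.
(* The carry identity summed against chi; the carry term vanishes by [sumE]. *)
have : (psi x + 1 - psi (x + 1)) * first_moment chi = 0.
  rewrite mulrBl mulrDl -(shift x x0) -(shift (x + 1) x1) /first_moment mul1r.
  rewrite -big_split -sumrB /= sum_units ?chi0 ?mul0r ?subr0 ?addr0//.
  transitivity (l%:R * \sum_(a : U) chi (uval a) * (demj_E k a)%:R);
    last by rewrite sumE mulr0.
  rewrite mulr_sumr; apply: eq_bigr => a _.
  rewrite -mulrDr -mulrBr mulrCA; congr (_ * _).
  have := congr1 (fun m => m%:R : C) (demj_E_mul k l_pr a).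
  by rewrite !natrD natrM => ->; rewrite addrAC subrr add0r.
move/eqP; rewrite mulf_eq0 (introF eqP mom0) orbF subr_eq0 => /eqP mu1.
have l1 : (0 < l.-1)%N by rewrite -subn1 subn_gt0 prime_gt1.
have psi_norm y : y != 0 -> `|psi y| = 1.
  move=> y0; apply/eqP; rewrite -(pexpr_eq1 l1)// -normrX -psiX Fp_Fermat//.
  by rewrite psi1 normr1.
set mu := psi x in mu1.
have mu3 : mu ^+ 2 + mu + 1 = 0.
  by apply: norm1_add1; rewrite ?mu1 psi_norm.
have mucub : mu ^+ 3 = 1.
  by apply/eqP; rewrite -subr_eq0 -(mulr0 (mu - 1)) -mu3; apply/eqP; ring.
have mu_neq1 : mu != 1.
  apply/eqP => m1; move/eqP: mu3; rewrite m1 expr1n -(natrD _ 1 1) -(natrD _ 2 1).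
  by rewrite pnatr_eq0.
have n3 : (3 %| n)%N.
  have mu_prim : 3.-primitive_root mu.
    have [m m_prim] := prim_order_exists (isT : (0 < 3)%N) mucub.
    move/(prime_nt_dvdP (isT : prime 3)) => m3; rewrite -m3//.
    by apply: contra_neq mu_neq1 => m1; have := prim_expr_order m_prim; rewrite m1.
  have : (3 %| l.-1)%N.
    by rewrite (prim_order_dvd mu_prim) -psiX Fp_Fermat// psi1.
  by rewrite lE addn1 /= Gauss_dvdr// coprimeXr.
have psiN1' : psi (-1) <> 1.
  by rewrite psiN1 => /eqP; rewrite -subr_eq0 -opprD oppr_eq0 -(natrD _ 1 1) pnatr_eq0.
have mun : mu ^+ n = 1 by move: n3 => /dvdnP[q ->]; rewrite mulnC exprM mucub expr1n.
(* The n-th power leaves only the 2-part, where psi = 1 forces the element to be 1. *)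
have pow2 (y : 'F_l) : y != 0 -> (y ^+ n) ^+ (2 ^ alpha) = 1.
  move=> y0; rewrite -exprM mulnC -[RHS](Fp_Fermat l_pr y0); congr (_ ^+ _).
  by rewrite lE addn1.
have xn : x ^+ n = 1.
  by apply: (@eq1_of_2pow_char psi alpha _ psiM psiN1' (pow2 _ x0)); rewrite psiX.
(* The sign matters: psi(-(x + 1)) = -(mu + 1) = mu^2 is a cube root of unity, so its n-th power is
   1. *)
have xn1 : (- (x + 1)) ^+ n = 1.
  apply: (@eq1_of_2pow_char psi alpha _ psiM psiN1' (pow2 _ _)); first by rewrite oppr_eq0.
  rewrite psiX -mulN1r psiM psiN1 -mu1 mulN1r.
  have -> : - (mu + 1) = mu ^+ 2 by apply/eqP; rewrite eq_sym -addr_eq0 addrA mu3.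
  by rewrite -exprM mulnC exprM mun expr1n.
split=> //.
  by move: xn1; rewrite exprNn -signr_odd n_odd expr1 mulN1r => e; rewrite -[LHS]opprK e.
apply/eqP => xx; move/eqP: mu_neq1; apply.
have ux : x \is a GRing.unit by rewrite unitfE.
have := chiW (FinRing.Unit ux) (cube_root_in_stab _ xx).
by rewrite /mu /psi /= => ->; rewrite ?invr1.
Qed.

End Roots.

Lemma singular_primesP (beta m l : nat) : odd m -> singular_primes beta m l ->
  prime l /\ exists alpha k, [/\ 0 < alpha, l = 2 ^ alpha * (3 ^ beta * m) + 1,
   3 %| 3 ^ beta * m & [/\ ((k%:R : 'F_l) ^+ (3 ^ beta * m) = 1)%R,
     ((k%:R + 1 : 'F_l) ^+ (3 ^ beta * m) = -1)%R & ((k%:R : 'F_l) ^+ 2 + k%:R + 1 != 0)%R]].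
Proof.
move=> m_odd [l_pr [alpha alpha_gt0 lE]] /card_gt0P[k]; rewrite inE =>
  /andP[/andP[k0 kl] /eqP det0].
split=> //; exists alpha, k; rewrite -mulnA in lE.
have n_odd : odd (3 ^ beta * m) by rewrite oddM oddX orbT.
by have [? ? ? ?] := @singular_roots Rdefinitions.R l k l_pr k0 kl alpha _ n_odd lE det0.
Qed.

(** * Counting *)

Lemma prod_primes_dvdn (s : seq nat) r : uniq s -> all prime s ->
  {in s, forall p, p %| r} -> \prod_(p <- s) p %| r.
Proof.
elim: s => [|p s IHs] /=; first by rewrite big_nil dvd1n.
move=> /andP[pNs s_uniq] /andP[p_pr s_pr] s_dvd; rewrite big_cons Gauss_dvd.
  rewrite s_dvd ?mem_head// IHs// => x xs; by rewrite s_dvd// inE xs orbT.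
rewrite prime_coprime//; apply: contra pNs.
elim: s s_pr {IHs s_uniq s_dvd} => [_|q s IHs /= /andP[q_pr s_pr]].
  by rewrite big_nil dvdn1 => /eqP p1; rewrite p1 in p_pr.
rewrite big_cons Euclid_dvdM// dvdn_prime2// inE => /orP[->//|/(IHs s_pr) ->].
by rewrite orbT.
Qed.

Lemma coprime6 m : coprime m 6 -> odd m /\ ~~ (3 %| m).
Proof.
rewrite (coprimeMr m 2 3) coprimen2 => /andP[-> ]; split=> //.
by rewrite -prime_coprime// coprime_sym.
Qed.

(** Here n = m, and a member would require 3 to divide it. *)
Lemma singular_primes0 m : coprime m 6 -> singular_primes 0 m = set0.
Proof.
move=> /coprime6[m_odd m3]; apply/seteqP; split=> l // /(singular_primesP m_odd).
by case=> _ [a [k [_ _]]]; rewrite mul1n (negPf m3).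
Qed.

(** With [beta.+1] the exponent n is 3 q for q = 3^beta m. The crude lower bound on [l] is what
    yields the factor 1/beta in the count. *)
Lemma singular_primes_dvdn beta m l : 1 <= m -> coprime m 6 ->
  singular_primes beta.+1 m l ->
  [/\ prime l, 2 ^ beta.+1 <= l & l %| absz (unity_resultant (3 ^ beta * m))].
Proof.
move=> m_gt0 /coprime6[m_odd _] /(singular_primesP m_odd)[l_pr [a [k [a0 lE _ [k1 k2 k3]]]]].
have q_gt0 : 0 < 3 ^ beta * m by rewrite muln_gt0 expn_gt0.
split=> //; last by apply: (dvdn_unity_resultant l_pr q_gt0 _ _ k3); rewrite mulnA -expnS.
rewrite lE (leq_trans (_ : _ <= 3 ^ beta.+1))//; first by rewrite leq_exp2r.
rewrite (leq_trans (leq_pmulr _ m_gt0))//.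
by rewrite (leq_trans (leq_pmull _ (_ : 0 < 2 ^ a)))// ?expn_gt0 ?leq_addr.
Qed.

Lemma finite_singular_primes beta m : 1 <= m -> coprime m 6 ->
  finite_set (singular_primes beta m).
Proof.
move=> m_gt0 m6; case: beta => [|beta]; first by rewrite singular_primes0.
have q_gt0 : 0 < 3 ^ beta * m by rewrite muln_gt0 expn_gt0.
apply: sub_finite_set (finite_II (absz (unity_resultant (3 ^ beta * m))).+1) => l.
move=> /(singular_primes_dvdn m_gt0 m6)[_ _ l_dvd]; rewrite /= ltnS.
by rewrite dvdn_leq// absz_gt0 unity_resultant_neq0.
Qed.

(** The product of these primes divides a nonzero integer of size at most 2^(2 n^2), and each is at
    least 2^(beta + 1); comparing exponents of 2 gives the bound. *)
Lemma card_singular_primes beta m : 1 <= m -> coprime m 6 ->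
  beta.+1 * #|` fset_set (singular_primes beta.+1 m)|
    <= 2 * (3 ^ (2 * beta.+1) * m ^ 2).
Proof.
move=> m_gt0 m6; set S := singular_primes _ _; set r := absz (unity_resultant (3 ^ beta * m)).
have q_gt0 : 0 < 3 ^ beta * m by rewrite muln_gt0 expn_gt0.
have r_gt0 : 0 < r by rewrite absz_gt0 unity_resultant_neq0.
have Sfin : finite_set S by exact: finite_singular_primes.
have SP l : l \in fset_set S -> [/\ prime l, 2 ^ beta.+1 <= l & l %| r].
  by rewrite in_fset_set// inE => /(singular_primes_dvdn m_gt0 m6).
have dvd : \prod_(l <- fset_set S) l %| r.
  apply: prod_primes_dvdn; first exact: fset_uniq.
    by apply/allP => l /SP[].
  by move=> l /SP[].
rewrite -(@leq_exp2l 2)// expnM.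
apply: (@leq_trans (\prod_(l <- fset_set S) l)).
  rewrite -iter_muln_1 -count_predT -big_const_seq big_seq [X in _ <= X]big_seq.
  by apply: leq_prod => l /SP[].
rewrite (leq_trans (dvdn_leq r_gt0 dvd))// (leq_trans (unity_resultant_le q_gt0))//.
by rewrite leq_exp2l// mulnA -expnS expnMn -expnM (mulnC _ 2).
Qed.

Theorem theorem5 :
  (forall beta m : nat, 1 <= m -> coprime m 6 ->
     finite_set (singular_primes beta m)) /\
  (forall m : nat, 1 <= m -> coprime m 6 ->
     #|` fset_set (singular_primes 0 m)| = 0) /\
  (exists C : rat, forall beta m : nat, 1 <= beta -> 1 <= m -> coprime m 6 ->
     ((#|` fset_set (singular_primes beta m)|)%:R
        <= C * ((3 ^ (2 * beta) * m ^ 2)%:R / beta%:R))%R).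
Proof.
split; first exact: finite_singular_primes.
split=> [m _ m6|]; first by rewrite singular_primes0// fset_set0 cardfs0.
exists 2%:R%R => -[//|beta] m _ m_gt0 m6.
have := card_singular_primes beta m_gt0 m6.
rewrite GRing.mulrA Num.Theory.ler_pdivlMr ?Num.Theory.ltr0n//.
by rewrite -!GRing.natrM Num.Theory.ler_nat mulnC.
Qed.
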